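(* For each $n\ge 2$ let $r=r_n\in[0,1/2]$ and let $\mathcal{G}_n=\{G_{ij}\}_{1\le i<j\le n}$ be a centered Gaussian field with $$\mathbb{E}(G_{ij}G_{kl})=\begin{cases}0 & \text{if } |\{i,j\}\cap\{k,l\}|=0,\\ r_n & \text{if } |\{i,j\}\cap\{k,l\}|=1,\\ 1 & \text{if } |\{i,j\}\cap\{k,l\}|=2.\end{cases}$$ Suppose that $(1-2r_n)\frac{\sqrt{\log n}}{\log\log n}\to\infty$ as $n\to\infty$. Then, with $c_n:=\sqrt{2\log n}$, $$\sqrt{2}\,c_n\left(\max_{1\le i<j\le n}G_{ij}-\sqrt{2}\,c_n+\frac{\log(4\sqrt{\pi}\,c_n)}{\sqrt{2}\,c_n}\right)$$ converges in distribution, as $n\to\infty$, to the standard Gumbel law with CDF $x\mapsto\exp(-e^{-x})$. *)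

(* Defs.v *)
From HB Require Import structures.
From mathcomp Require Import all_boot all_order all_algebra.
From mathcomp Require Import all_classical all_reals all_analysis.
Set Implicit Arguments. Unset Strict Implicit. Unset Printing Implicit Defensive.
Import Order.TTheory GRing.Theory Num.Theory.
Import numFieldNormedType.Exports.
Local Open Scope classical_set_scope.
Local Open Scope ring_scope.

Definition pair_cov {R : realType} (n : nat) (r : R) (i j k l : 'I_n) : R :=
  let c := #|[set i; j] :&: [set k; l]| in
  if c == 0%N then 0 else if c == 1%N then r else 1.

Definition lin_comb {R : realType} {T : Type} (n : nat)
  (a : 'I_n -> 'I_n -> R) (X : 'I_n -> 'I_n -> T -> R) (t : T) : R :=
  \sum_(i < n) \sum_(j < n | (i < j)%N) a i j * X i j t.

Definition pair_quad {R : realType} (n : nat) (C : 'I_n -> 'I_n -> 'I_n -> 'I_n -> R)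
  (a : 'I_n -> 'I_n -> R) : R :=
  \sum_(i < n) \sum_(j < n | (i < j)%N) \sum_(k < n) \sum_(l < n | (k < l)%N)
     a i j * a k l * C i j k l.

(* A centered Gaussian field {X_ij}_{i<j} with covariance C: every linear
   combination sum a_ij X_ij has law N(0, q(a)), where q(a) is the quadratic
   form of C (the degenerate law N(0,0) being the Dirac mass at 0). *)
Definition centered_gaussian_field {R : realType} {d : measure_display}
  {T : measurableType d} (P : probability T R) (n : nat)
  (C : 'I_n -> 'I_n -> 'I_n -> 'I_n -> R) (X : 'I_n -> 'I_n -> T -> R) : Prop :=
  (forall i j : 'I_n, (i < j)%N -> measurable_fun setT (X i j)) /\
  forall a : 'I_n -> 'I_n -> R, forall A : set R, measurable A ->
    let q := pair_quad C a in
    P (lin_comb a X @^-1` A) =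
      (if q == 0 then \d_(0 : R) A else normal_prob 0 (Num.sqrt q) A).

Definition pair_max {R : realType} {T : Type} (n : nat)
  (X : 'I_n -> 'I_n -> T -> R) (t : T) : \bar R :=
  \big[Order.max/-oo%E]_(i < n) \big[Order.max/-oo%E]_(j < n | (i < j)%N)
     (X i j t)%:E.

(* Main.v *)
Require Import Defs.
From HB Require Import structures.
From mathcomp Require Import all_boot all_order all_algebra.
From mathcomp Require Import all_classical all_reals all_analysis.
From mathcomp Require Import measurable_realfun ring lra.
Import Order.TTheory GRing.Theory Num.Theory.
Import numFieldNormedType.Exports.
Set Implicit Arguments.
Unset Strict Implicit.
Local Open Scope classical_set_scope.
Local Open Scope ring_scope.

(* Put [eps = 1 - 2 r] and let [u] be the level with
   [sqrt 2 c (u - sqrt 2 c + ln (4 sqrt pi c) / (sqrt 2 c)) = x].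
   The field has the law of [sqrt r (Z_i + Z_j) + sqrt eps W_ij] for independent
   standard Gaussians [Z_i], [W_ij], so that, conditionally on [Z], the event
   [max <= u] has probability [prod_(i < j) (1 - q (Z_i, Z_j))].  With
   probability tending to 1 all the [Z_i] are at most [c = sqrt (2 ln n)], and
   then the [q (Z_i, Z_j)] are uniformly small.  The truncated sum
   [S = sum_(i < j) q (Z_i, Z_j) 1_{Z_i, Z_j <= c}] converges to [exp (- x)] in
   probability, by a second moment computation, and the product is close to
   [exp (- S)].  The truncation is what makes the second moment work for [r]
   close to [1/2]: up to a power of [c], the pairs of pairs with a common index
   contribute [exp (- c^2 (1 - sqrt (2 r))^2 / 2)], which beats every power of
   [ln n] since [eps sqrt (ln n) / ln ln n] tends to infinity. *)

(** * Gaussian laws *)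

(** [centered_gaussian_field] gives only the laws of linear combinations, so the passage to the
    explicit field has to be proved. The indicator of an orthant is approximated by sums of cosines
    of affine forms in the coordinates, and those laws determine the means of such sums.

    Without truncation, the mean of [q (Z_1, Z_2) q (Z_1, Z_3)] is the probability that two
    Gaussians of correlation [r] both exceed [u], roughly [n ^ (- 4 / (1 + r))]. There are of the
    order of [n ^ 3] such terms, so for [r > 1/3] they swamp the second moment of the sum although
    its mean stays bounded: rare large values of [Z_1] are to blame. The level [c] is the natural
    cut, because [exp (- c^2 / 2)] is exactly [1 / n], and the expected number of [Z_i] above [c]
    still vanishes like [1 / c].

    The bounds on the lost mass and on the common-index terms are Gaussian tilts with parameter
    [sqrt 2 c], the leading term of [u]. Both carry the same exponential gap, and
    [1 - sqrt (2 r) >= eps / 2] lets the growth hypothesis on [eps] control it. *)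

Section density.
Context d (T : measurableType d) (R : realType).
Local Open Scope ereal_scope.
Import HBNNSimple.

(** On simple functions linearity reduces the identity to the hypothesis on sets; monotone
    convergence on both sides does the rest. *)
Lemma ge0_integral_density (mu nu : {measure set T -> \bar R}) (p : T -> R)
  (f : T -> \bar R) :
  measurable_fun setT p -> (forall x, (0 <= p x)%R) ->
  (forall A, measurable A -> nu A = \int[mu]_(x in A) (p x)%:E) ->
  measurable_fun setT f -> (forall x, 0 <= f x) ->
  \int[nu]_x f x = \int[mu]_x (f x * (p x)%:E).
Proof.
move=> mp p0 nuE mf f0.
pose f_ := nnsfun_approx measurableT mf.
have cf x : EFin \o f_ ^~ x @ \oo --> f x by apply: cvg_nnsfun_approx.
transitivity (limn (fun n => \int[nu]_x (f_ n x)%:E)).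
  rewrite -monotone_convergence//.
  - by apply: eq_integral => x _; apply/esym/cvg_lim => //; exact: cf.
  - by move=> n; exact/measurable_EFinP/measurable_funTS.
  - by move=> *; rewrite lee_fin.
  - by move=> x _ m n mn; rewrite lee_fin; exact/lefP/nd_nnsfun_approx.
transitivity (limn (fun n => \int[mu]_x ((f_ n x)%:E * (p x)%:E))).
  congr (limn _); apply/funext => n.
  under eq_integral do rewrite fimfunE// -fsumEFin//.
  rewrite ge0_integral_fsum//; last 2 first.
    by move=> r; exact/measurable_EFinP/measurableT_comp.
    by move=> r x _; rewrite nnfun_muleindic_ge0.
  under [RHS]eq_integral.
    move=> x _; rewrite fimfunE// -fsumEFin// ge0_mule_fsuml; last first.
      by move=> r; rewrite nnfun_muleindic_ge0.
    over.
  rewrite ge0_integral_fsum//; last 2 first.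
    move=> r; apply/emeasurable_funM; apply/measurable_EFinP => //.
    exact/measurableT_comp.
    by move=> r x _; rewrite mule_ge0// ?nnfun_muleindic_ge0// lee_fin.
  apply: eq_fsbigr => r rf.
  rewrite integralZl_indic_nnsfun// integral_indic//= setIT.
  rewrite nuE//.
  (* A nonnegative simple function has empty fibres over negative values, so both sides vanish
     there. *)
  have [r0|r0] := leP 0%R r; last first.
    rewrite preimage_nnfun0// integral_set0 mule0.
    by under eq_integral do rewrite indic0 mulr0 mul0e; rewrite integral0.
  rewrite [X in _ * X]integral_mkcond.
  rewrite -ge0_integralZl//; last 2 first.
    apply/(measurable_restrictT _ _).1 => //.
    by apply: measurable_funTS; exact/measurable_EFinP.
    by move=> x _; apply: erestrict_ge0 => *; rewrite lee_fin.
  apply: eq_integral => x _; rewrite EFinM patchE indicE -muleA.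
  by case: ifPn => _; rewrite ?mul1e ?mul0e.
rewrite -monotone_convergence//.
- apply: eq_integral => x _; apply/cvg_lim => //.
  by apply: cvgeZr => //; exact: cf.
- move=> n; apply/emeasurable_funM; apply/measurable_EFinP => //.
- by move=> n x _; rewrite mule_ge0// lee_fin.
- move=> x _ m n mn; rewrite lee_wpmul2r// ?lee_fin//; exact/lefP/nd_nnsfun_approx.
Qed.
End density.

Section image_measure.
Context d1 d2 (T1 : measurableType d1) (T2 : measurableType d2) (R : realType).
Variables (m : {measure set T1 -> \bar R}) (f : T1 -> T2).
Hypothesis mf : measurable_fun setT f.

(** The measure structure is built from the proof [mf], so [f] may be a bare function. *)
Definition image_measure : {measure set T2 -> \bar R} :=
  @measure_function_pushforward__canonical__measure_function_Measure _ _ T1 T2 R m f mf.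

Lemma ge0_integral_image_measure (g : T2 -> \bar R) :
  measurable_fun setT g -> (forall x, (0 <= g x)%E) ->
  (\int[image_measure]_x g x = \int[m]_x g (f x))%E.
Proof. by move=> mg g0; rewrite (ge0_integral_pushforward mf m measurableT mg). Qed.

End image_measure.

Section affine.
Context {R : realType}.
Local Notation mu := (@lebesgue_measure R).

Lemma measurable_affine (a b : R) :
  measurable_fun setT (fun x : measurableTypeR R => a * x + b : measurableTypeR R).
Proof. by apply: measurable_funD => //; exact: measurable_funM. Qed.

(** The rescaled image measure agrees with Lebesgue measure on half-open intervals, which determine
    it. A negative [a] moves the closed end to the left, without effect on the length. *)
Lemma lebesgue_measure_affine (a b : R) (A : set R) : a != 0 -> measurable A ->
  (`|a|%:E * mu ((fun x => a * x + b)%R @^-1` A) = mu A)%E.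
Proof.
move=> a0 mA.
have ma := measurable_affine a b.
pose m := mscale (NngNum (normr_ge0 a)) (image_measure mu ma).
suff : mu A = m A by move=> ->; reflexivity.
apply: lebesgue_measure_unique => // _ [[x y]] _ <-.
change (mu `]x, y] = `|a|%:E * mu ((fun z => (a * z + b)%R) @^-1` `]x, y]))%E.
have [a1|a1] := ltP 0 a.
  rewrite (_ : _ @^-1` _ = `](x - b) / a, (y - b) / a]%classic); last first.
    apply/seteqP; split=> z /=; rewrite !in_itv/= ler_pdivlMr// ltr_pdivrMr// ltrBlDr
      lerBrDr (mulrC z)//.
  rewrite !lebesgue_measure_itv/= !lte_fin ltr_pM2r ?invr_gt0// ltrD2r.
  case: ifPn => _; last by rewrite mule0.
  by rewrite -!EFinB -EFinM gtr0_norm//; congr EFin; field.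
have {a0}a1 : a < 0 by rewrite lt_neqAle a0.
rewrite (_ : _ @^-1` _ = `[(y - b) / a, (x - b) / a[%classic); last first.
  apply/seteqP; split=> z /=; rewrite !in_itv/= ler_ndivrMr// ltr_ndivlMr// ltrBlDr
    lerBrDr (mulrC z) andbC//.
rewrite !lebesgue_measure_itv/= !lte_fin ltr_nM2r ?invr_lt0// ltrD2r.
case: ifPn => _; last by rewrite mule0.
by rewrite -!EFinB -EFinM ltr0_norm//; congr EFin; field; rewrite lt_eqF.
Qed.

Lemma ge0_integral_affine (a b : R) (f : R -> \bar R) : a != 0 ->
  measurable_fun setT f -> (forall x, (0 <= f x)%E) ->
  (\int[mu]_x f x = \int[mu]_x (`|a|%:E * f (a * x + b)%R))%E.
Proof.
move=> a0 mf f0; have ma := measurable_affine a b.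
rewrite ge0_integralZl//; last exact: (measurableT_comp mf ma).
rewrite -(ge0_integral_image_measure mu ma mf f0).
rewrite [LHS](@eq_measure_integral _ _ _ _ (mscale (NngNum (normr_ge0 a))
  (image_measure mu ma))).
  by rewrite ge0_integral_mscale.
by move=> A mA _; exact/esym/lebesgue_measure_affine.
Qed.

End affine.

Section normal_laws.
Context {R : realType}.
Local Notation mu := (@lebesgue_measure R).

Lemma normal_pdf_sqr (m s x : R) : s != 0 ->
  normal_pdf m s x = (Num.sqrt (s ^+ 2 * pi *+ 2))^-1 * expR (- (x - m)
    ^+ 2 / (s ^+ 2 *+ 2)).
Proof. by move=> s0; rewrite normal_pdfE. Qed.

(** The density sees [s] only through its square, which removes the sign of [a * s] left by
    [normal_prob_affine]. *)
Lemma normal_prob_sqr (m s t : R) : s != 0 -> t != 0 -> s ^+ 2 = t ^+ 2 ->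
  normal_prob m s = normal_prob m t.
Proof.
move=> s0 t0 st; apply/funext => A; apply: eq_integral => x _.
by rewrite !normal_pdf_sqr// st.
Qed.

Lemma ge0_integral_normal_prob (m s : R) (f : R -> \bar R) :
  measurable_fun setT f -> (forall x, (0 <= f x)%E) ->
  (\int[normal_prob m s]_x f x = \int[mu]_x (f x * (normal_pdf m s x)%:E))%E.
Proof.
move=> mf f0; apply: ge0_integral_density => //; first exact: measurable_normal_pdf.
by move=> x; exact: normal_pdf_ge0.
Qed.

Lemma normal_pdf_affine (m s a b x : R) : s != 0 -> a != 0 ->
  `|a| * normal_pdf (a * m + b) (a * s) (a * x + b) = normal_pdf m s x.
Proof.
move=> s0 a0; rewrite !normal_pdf_sqr ?mulf_neq0// mulrA; congr (_ * expR _).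
  rewrite exprMn -mulrA -mulrnAr sqrtrM ?sqr_ge0// sqrtr_sqr invfM mulrA.
  by rewrite divff ?mul1r// normr_eq0.
by field; rewrite s0 a0.
Qed.

Lemma normal_prob_affine (m s a b : R) (A : set R) : s != 0 -> a != 0 -> measurable A ->
  normal_prob m s ((fun x => a * x + b) @^-1` A) = normal_prob (a * m + b) (a * s) A.
Proof.
move=> s0 a0 mA; have ma := measurable_affine a b.
rewrite /normal_prob integral_mkcond [RHS]integral_mkcond.
rewrite [RHS](ge0_integral_affine b a0); last 2 first.
  apply/(measurable_restrictT _ _).1 => //.
  by apply: measurable_funTS; apply/measurable_EFinP; exact: measurable_normal_pdf.
  by move=> x; apply: erestrict_ge0 => *; rewrite lee_fin normal_pdf_ge0.
apply: eq_integral => x _; rewrite !patchE.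
rewrite (_ : (x \in _) = ((a * x + b) \in A)); last first.
  by apply/idP/idP; rewrite !inE.
by case: ifPn => _; rewrite ?mule0// -EFinM normal_pdf_affine.
Qed.

(** Bayes' rule for a normal prior and a normal likelihood: the joint density is the marginal
    density of [y] times the density of [x] given [y]. The exponents agree by completing the square
    in [x]. *)
Lemma normal_pdf_conv (s t x y : R) : s != 0 -> t != 0 ->
  normal_pdf x t y * normal_pdf 0 s x =
  normal_pdf (s ^+ 2 * y / (s ^+ 2 + t ^+ 2)) (s * t / Num.sqrt (s ^+ 2 + t ^+ 2)) x *
  normal_pdf 0 (Num.sqrt (s ^+ 2 + t ^+ 2)) y.
Proof.
move=> s0 t0.
have s20 : 0 < s ^+ 2 by rewrite exprn_even_gt0.
have t20 : 0 < t ^+ 2 by rewrite exprn_even_gt0.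
have st0 : 0 < s ^+ 2 + t ^+ 2 by rewrite addr_gt0.
have sst0 : 0 < Num.sqrt (s ^+ 2 + t ^+ 2) by rewrite sqrtr_gt0.
rewrite !normal_pdf_sqr ?mulf_neq0 ?invr_eq0 ?(gt_eqF sst0)//.
rewrite [LHS]mulrACA [RHS]mulrACA -!expRD; congr (_ * expR _).
  rewrite -!invfM; congr (_^-1); rewrite -!sqrtrM; last 2 first.
    by rewrite mulrn_wge0// mulr_ge0 ?sqr_ge0// pi_ge0.
    by rewrite mulrn_wge0// mulr_ge0 ?sqr_ge0// pi_ge0.
  congr (Num.sqrt _); rewrite expr_div_n sqr_sqrtr ?(ltW st0)//.
  by field; rewrite gt_eqF.
rewrite !subr0 expr_div_n sqr_sqrtr ?(ltW st0)//.
by field; rewrite s0 t0 gt_eqF.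
Qed.

(** Indexed by the variance and including the Dirac mass, so that scaling and addition of variances
    hold for every [q >= 0], and so that it is literally the law in [centered_gaussian_field]. *)
Definition gauss (q : R) : probability (measurableTypeR R) R :=
  if q == 0 then (\d_(0 : measurableTypeR R) : probability (measurableTypeR R) R)
  else (normal_prob 0 (Num.sqrt q) : probability (measurableTypeR R) R).

Lemma gaussE (q : R) A :
  gauss q A = (if q == 0 then \d_(0 : R) A else normal_prob 0 (Num.sqrt q) A).
Proof. by rewrite /gauss; case: ifP. Qed.

Lemma gauss_scale (q a : R) A : 0 <= q -> measurable A ->
  gauss q ((fun x => a * x) @^-1` A) = gauss (a ^+ 2 * q) A.
Proof.
move=> q0 mA; apply: (etrans (gaussE q _));
  apply: (etrans _ (esym (gaussE (a ^+ 2 * q) _))).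
rewrite mulf_eq0 expf_eq0/=.
have [->|qn0] := eqVneq q 0.
  rewrite orbT !diracE; congr (_%:R%:E); congr nat_of_bool.
  by apply/idP/idP; rewrite !inE/= mulr0.
have [->|an0]/= := eqVneq a 0.
  rewrite diracE; have [A0|A0] := pselect (A 0).
    rewrite mem_set// (_ : _ @^-1` _ = setT) ?probability_setT//.
    by apply/seteqP; split=> // x _ /=; rewrite mul0r.
  rewrite memNset// (_ : _ @^-1` _ = set0) ?measure0//.
  by apply/seteqP; split=> // x /=; rewrite mul0r.
have sq0 : Num.sqrt q != 0 by rewrite gt_eqF// sqrtr_gt0 lt_neqAle eq_sym qn0.
rewrite (_ : (fun x => a * x) = (fun x => a * x + 0)); last first.
  by apply/funext => x; rewrite addr0.
rewrite (@normal_prob_affine 0 _ a 0 A sq0 an0 mA).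
have -> : a * 0 + 0 = 0 by rewrite mulr0 addr0.
rewrite (@normal_prob_sqr _ _ (Num.sqrt (a ^+ 2 * q)))//.
- by rewrite mulf_neq0.
- by rewrite sqrtrM ?sqr_ge0// mulf_neq0// sqrtr_sqr normr_eq0.
- by rewrite exprMn !sqr_sqrtr// mulr_ge0// sqr_ge0.
Qed.

Lemma measurable_gauss_shift (q : R) A : measurable A ->
  measurable_fun setT (fun x : R => gauss q ((fun y => x + y)%R @^-1` A)).
Proof.
move=> mA.
have mB : measurable ((fun z : R * R => z.1 + z.2) @^-1` A).
  rewrite -[X in measurable X]setTI.
  by apply: (measurable_funD measurable_fst measurable_snd).
have := measurable_fun_xsection (gauss q) mB.
congr measurable_fun; apply/funext => x /=; congr (gauss q _).
by apply/seteqP; split=> y /=; rewrite /xsection/= inE.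
Qed.

Lemma measurable_normal_pdf2 (t : R) : t != 0 ->
  measurable_fun setT (fun z : R * R => normal_pdf z.1 t z.2).
Proof.
move=> t0; under eq_fun do rewrite normal_pdf_sqr//.
apply: measurable_funM => //; apply: measurableT_comp => //.
apply: measurable_funM => //; apply: measurableT_comp => //.
by apply: measurable_funX; apply: measurable_funB.
Qed.

(** After Tonelli, [normal_pdf_conv] turns the inner integral into the total mass of a normal law.
    The degenerate variances have no density and are treated first. *)
Lemma gauss_conv (q1 q2 : R) A : 0 <= q1 -> 0 <= q2 -> measurable A ->
  (\int[gauss q1]_x gauss q2 ((fun y => x + y)%R @^-1` A) = gauss (q1 + q2) A)%E.
Proof.
move=> q10 q20 mA.
have [->|q2n0] := eqVneq q2 0.
  rewrite addr0; under eq_integral.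
    move=> x _; rewrite gaussE eqxx diracE.
    rewrite (_ : (_ \in _) = (x \in A)); last first.
      by apply/idP/idP; rewrite !inE/= addr0.
    rewrite -/(\1_A x) ; over.
  by rewrite integral_indic// setIT.
have [->|q1n0] := eqVneq q1 0.
  have mk := @measurable_gauss_shift q2 A mA.
  rewrite add0r (_ : gauss 0 = \d_(0 : measurableTypeR R)); last by rewrite /gauss eqxx.
  rewrite integral_dirac//= diracT mul1e.
  by congr (gauss _ _); apply/seteqP; split => x /=; rewrite add0r.
have s0 : Num.sqrt q1 != 0 by rewrite gt_eqF// sqrtr_gt0 lt_neqAle eq_sym q1n0.
have t0 : Num.sqrt q2 != 0 by rewrite gt_eqF// sqrtr_gt0 lt_neqAle eq_sym q2n0.
have [q1g q2g] : 0 < q1 /\ 0 < q2 by rewrite !lt_neqAle ![0 == _]eq_sym q1n0 q2n0.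
have r0 : Num.sqrt (q1 + q2) != 0 by rewrite gt_eqF// sqrtr_gt0 addr_gt0.
pose f (z : R * R) := (\1_A z.2 * (normal_pdf z.1 (Num.sqrt q2) z.2 *
   normal_pdf 0 (Num.sqrt q1) z.1))%R.
have f0 z : (0 <= f z)%R by rewrite !mulr_ge0// normal_pdf_ge0.
have mf : measurable_fun setT f.
  apply: measurable_funM; first by apply: measurableT_comp.
  apply: measurable_funM; first exact: measurable_normal_pdf2.
  by apply: measurableT_comp => //; exact: measurable_normal_pdf.
transitivity (\int[mu]_x \int[mu]_y (EFin \o f) (x, y))%E.
  rewrite {1}/gauss (negbTE q1n0) ge0_integral_normal_prob//; last first.
    exact: measurable_gauss_shift.
  apply: eq_integral => x _.
  rewrite gaussE (negbTE q2n0).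
  rewrite (_ : (fun y => (x + y)%R) = (fun y => (1 * y + x)%R)); last first.
    by apply/funext => y; rewrite mul1r addrC.
  rewrite normal_prob_affine ?oner_neq0// mulr0 add0r mul1r /normal_prob.
  rewrite integral_mkcond muleC -ge0_integralZl//; last 3 first.
  - apply/(measurable_restrictT _ _).1 => //.
    by apply: measurable_funTS; apply/measurable_EFinP; exact: measurable_normal_pdf.
  - by move=> y _; apply: erestrict_ge0 => *; rewrite lee_fin normal_pdf_ge0.
  - by rewrite lee_fin normal_pdf_ge0.
  apply: eq_integral => y _; rewrite /f patchE/= indicE.
  by case: ifPn => _; rewrite ?mul0r ?mule0// mul1r -EFinM mulrC.
transitivity (\int[mu]_y \int[mu]_x (EFin \o f) (x, y))%E.
  apply: (@fubini_tonelli _ _ _ _ R mu mu (EFin \o f)).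
    exact/measurable_EFinP.
  by move=> z; rewrite /= lee_fin.
rewrite gaussE paddr_eq0// (negbTE q1n0)/= /normal_prob [RHS]integral_mkcond.
apply: eq_integral => y _; rewrite /f/= patchE indicE.
case: ifPn => _; last by under eq_integral do rewrite mul0r; rewrite integral0.
under eq_integral.
  move=> x _; rewrite mul1r normal_pdf_conv// !sqr_sqrtr// EFinM; over.
rewrite ge0_integralZr//; last 3 first.
- by apply/measurable_EFinP; exact: measurable_normal_pdf.
- by move=> x _; rewrite lee_fin normal_pdf_ge0.
- by rewrite lee_fin normal_pdf_ge0.
by rewrite integral_normal_pdf mul1e.
Qed.

End normal_laws.

(** * Gaussian tails *)

Section gaussian_tails.
Context {R : realType}.
Local Notation mu := (@lebesgue_measure R).
Implicit Types a b t u x : R.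

Lemma gauss1 : gauss (1 : R) = normal_prob 0 1 :> (set R -> \bar R).
Proof. by apply/funext => A; rewrite gaussE oner_eq0 sqrtr1. Qed.

Lemma ge0_integral_gauss1 (f : R -> \bar R)
  : measurable_fun setT f -> (forall x, (0 <= f x)%E) ->
  (\int[gauss 1]_x f x = \int[mu]_x (f x * (normal_pdf 0 1 x)%:E))%E.
Proof.
move=> mf f0; rewrite -ge0_integral_normal_prob//.
apply: eq_measure_integral => A mA _.
exact: (congr1 (fun m : set R -> \bar R => m A) gauss1).
Qed.

Lemma measurable_expR_affine a b : measurable_fun setT (fun x : R => expR (a * x + b)).
Proof. by apply: measurableT_comp => //; exact: measurable_affine. Qed.

(** Tilting the standard density by [expR (a * x)] gives the density of mean [a], up to the factor
    [expR (a ^+ 2 / 2)]. *)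
Lemma gauss1_mgf a b :
  (\int[gauss 1]_x (expR (a * x + b))%:E = (expR (a ^+ 2 / 2 + b))%:E)%E.
Proof.
rewrite ge0_integral_gauss1//; last first.
  by apply/measurable_EFinP; exact: measurable_expR_affine.
transitivity (\int[mu]_x ((expR (a ^+ 2 / 2 + b))%:E * (normal_pdf a 1 x)%:E))%E.
  apply: eq_integral => x _; rewrite -!EFinM !normal_pdf_sqr ?oner_neq0//.
  congr EFin; rewrite mulrCA [RHS]mulrCA -!expRD; congr (_ * expR _).
  by field.
rewrite ge0_integralZl//.
- by rewrite integral_normal_pdf mule1.
- by apply/measurable_EFinP; exact: measurable_normal_pdf.
- by move=> x _; rewrite lee_fin normal_pdf_ge0.
Qed.

(** The indicator of [t < x] is at most [expR (a * (x - t))]. *)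
Lemma gauss1_chernoff a t : 0 <= a ->
  (gauss 1 `]t, +oo[%classic <= (expR (a ^+ 2 / 2 - a * t))%:E)%E.
Proof.
move=> a0; rewrite -gauss1_mgf -[X in gauss 1 X]setIT -integral_indic//.
apply: ge0_le_integral => //.
- by apply/measurable_EFinP.
- by apply/measurable_EFinP; exact: measurable_expR_affine.
- move=> x _; rewrite lee_fin indicE; case: (boolP (x \in _)) => [|_]; last exact: expR_ge0.
  rewrite inE/= in_itv/= andbT => tx; rewrite -[leLHS]expR0 ler_expR -mulrBr.
  by rewrite mulr_ge0// subr_ge0 ltW.
Qed.

Lemma continuous_expR_sqr : continuous (fun x : R => expR (- (x ^+ 2 / 2))).
Proof.
move=> x; apply: continuous_comp; last exact: continuous_expR.
apply: (@cvgN _ R^o); apply: cvgM; last exact: cvg_cst.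
exact: exprn_continuous.
Qed.

Lemma continuous_mills u : 0 < u ->
  {within `[u, +oo[, continuous (fun x => expR (- (x ^+ 2 / 2)) * (1 + x ^- 2))}.
Proof.
move=> u0; apply: continuous_in_subspaceT => x; rewrite inE/= in_itv/= andbT => ux.
  apply: cvgM; first exact: continuous_expR_sqr.
  apply: (@cvgD _ R^o); first exact: cvg_cst.
  apply: cvgV; first by rewrite expf_neq0// gt_eqF// (lt_le_trans u0).
  exact: exprn_continuous.
Qed.

(** The integrand has the explicit primitive [F]. On the domain the factor [1 + x ^- 2] lies between
    1 and [1 + u ^- 2], which turns this one identity into both tail bounds below. *)
Lemma integral_mills u : 0 < u ->
  (\int[mu]_(x in `[u, +oo[) (expR (- (x ^+ 2 / 2)) * (1 + x ^- 2))%:E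
   = (expR (- (u ^+ 2 / 2)) / u)%:E)%E.
Proof.
move=> u0.
pose F x : R := - (expR (- (x ^+ 2 / 2)) / x).
have dF x : 0 < x -> is_derive x 1 F (expR (- (x ^+ 2 / 2)) * (1 + x ^- 2)).
  move=> x0; have xn0 : x != 0 by rewrite gt_eqF.
  have d1 : is_derive x 1 (fun y : R => - (y ^+ 2 / 2)) (- x).
    by apply: is_derive_eq; rewrite /GRing.scale/=; field.
  have d2 : is_derive x 1 (expR \o (fun y : R => - (y ^+ 2 / 2))) (expR (- (x ^+ 2 / 2))
    * - x).
    exact: is_derive1_comp.
  have d3 : is_derive x 1 (fun y : R => y^-1) (- x ^- 2).
    by have := @is_deriveV R id x 1 1 xn0 _; rewrite /GRing.scale/= mulr1; apply.
  have d4 := is_deriveN (is_deriveM d2 d3).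
  refine (@is_derive_eq _ _ _ _ _ _ _ _ d4 _).
  by rewrite /GRing.scale/=; field.
rewrite (@ge0_continuous_FTC2y _ _ F u 0).
- by rewrite /F -EFinB sub0r opprK.
- by move=> x ux; rewrite mulr_ge0 ?expR_ge0// addr_ge0// invr_ge0 sqr_ge0.
- exact: continuous_mills.
- rewrite -oppr0; apply: (@cvgN _ R^o).
  apply: (@squeeze_cvgr _ _ _ _ (fun=> 0) (fun x : R => x^-1)).
  + near=> x; have x0 : 0 < x by near: x; exact: nbhs_pinfty_gt.
    rewrite divr_ge0 ?expR_ge0 ?(ltW x0)//= ler_piMl ?invr_ge0 ?(ltW x0)//.
    by rewrite -[leRHS]expR0 ler_expR oppr_le0 divr_ge0// sqr_ge0.
  + exact: cvg_cst.
  + apply/(@gtr0_cvgV0 _ _ _ _ id); last exact: cvg_id.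
    exact: nbhs_pinfty_gt.
- by move=> x ux; apply: (@ex_derive _ _ _ _ _ _ _ (dF x (lt_trans u0 ux))).
- apply: cvg_at_right_filter.
  have := @ex_derive _ _ _ _ _ _ _ (dF u u0).
  by move/derivable1_diffP/differentiable_continuous.
- move=> x; rewrite in_itv/= andbT => ux.
  by rewrite derive1E (@derive_val _ _ _ _ _ _ _ (dF x (lt_trans u0 ux))).
Unshelve. all: by end_near. Qed.

(** The standard normal density at [u] divided by [u], the leading term of the tail. *)
Definition mills u := expR (- (u ^+ 2 / 2)) / (Num.sqrt (2 * pi) * u).

Lemma gauss1_tailE u : gauss 1 `]u, +oo[%classic =
  (\int[mu]_(x in `[u, +oo[) ((Num.sqrt (2 * pi))^-1 * expR (- (x ^+ 2 / 2)))%:E)%E.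
Proof.
rewrite (congr1 (fun m : set R -> \bar R => m _) gauss1) /normal_prob.
rewrite integral_itv_obnd_cbnd; last first.
  apply: measurable_funTS; apply/measurable_EFinP; exact: measurable_normal_pdf.
apply: eq_integral => x _; rewrite normal_pdf_sqr ?oner_neq0// subr0 expr1n mul1r.
by rewrite (mulr_natl pi) mulNr.
Qed.

Lemma measurable_mills u : 0 < u ->
  measurable_fun `[u, +oo[ (fun x : R => (expR (- (x ^+ 2 / 2)) * (1 + x ^- 2))%:E).
Proof.
move=> u0; apply/measurable_EFinP; apply: subspace_continuous_measurable_fun => //.
exact: continuous_mills.
Qed.

Lemma measurable_expR_sqr (D : set R) :
  measurable_fun D (fun x : R => ((Num.sqrt (2 * pi))^-1 * expR (- (x ^+ 2 / 2)))%:E).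
Proof.
apply: measurable_funTS; apply/measurable_EFinP; apply: measurable_funM => //.
apply: continuous_measurable_fun; exact: continuous_expR_sqr.
Qed.

Lemma mills_ge0 x : 0 <= expR (- (x ^+ 2 / 2)) * (1 + x ^- 2).
Proof. by rewrite mulr_ge0 ?expR_ge0// addr_ge0// invr_ge0 sqr_ge0. Qed.

Lemma gauss1_tail_ub u : 0 < u -> (gauss 1 `]u, +oo[%classic <= (mills u)%:E)%E.
Proof.
move=> u0; rewrite gauss1_tailE /mills invfM mulrCA EFinM.
have k0 : (0 : R) <= (Num.sqrt (2 * pi))^-1 by rewrite invr_ge0.
rewrite -integral_mills// -ge0_integralZl//; last 2 first.
- exact: measurable_mills.
- by move=> x _; rewrite lee_fin mills_ge0.
apply: ge0_le_integral => //.
- exact: measurable_expR_sqr.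
- by apply: emeasurable_funM => //; exact: measurable_mills.
- move=> x _; rewrite -EFinM lee_fin ler_wpM2l// ler_peMr ?expR_ge0// lerDl.
  by rewrite invr_ge0 sqr_ge0.
Qed.

Lemma gauss1_tail_lb u : 0 < u -> ((mills u)%:E <= (1 + u ^- 2)%:E * gauss 1 `]u,
  +oo[%classic)%E.
Proof.
move=> u0; rewrite gauss1_tailE /mills invfM mulrCA EFinM.
have k0 : (0 : R) <= (Num.sqrt (2 * pi))^-1 by rewrite invr_ge0.
rewrite -integral_mills// -ge0_integralZl//; last 2 first.
- exact: measurable_mills.
- by move=> x _; rewrite lee_fin mills_ge0.
rewrite -ge0_integralZl//; last 2 first.
- exact: measurable_expR_sqr.
- by rewrite lee_fin addr_ge0// invr_ge0 sqr_ge0.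
apply: ge0_le_integral => //.
- by move=> x _; rewrite -EFinM lee_fin mulr_ge0// mills_ge0.
- by apply: emeasurable_funM => //; exact: measurable_mills.
- by apply: emeasurable_funM => //; exact: measurable_expR_sqr.
- move=> x; rewrite /= in_itv/= andbT => ux.
  rewrite -!EFinM lee_fin mulrA [leRHS]mulrC ler_wpM2l//.
  rewrite lerD2l lef_pV2 ?posrE ?exprn_gt0// ?(lt_le_trans u0 ux)//.
  by rewrite ler_pXn2r// nnegrE ?ltW// (lt_le_trans u0).
Qed.

Definition gauss_tail (t : R) : R := fine (gauss 1 `]t, +oo[%classic).

Lemma gauss_tailE t : gauss 1 `]t, +oo[%classic = (gauss_tail t)%:E.
Proof. by rewrite fineK// fin_num_measure. Qed.

Lemma gauss_tail_itv t : 0 <= gauss_tail t <= 1.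
Proof. by rewrite -!lee_fin -gauss_tailE measure_ge0/= probability_le1. Qed.

Lemma gauss_le t : gauss 1 [set y : R | y <= t] = (1 - gauss_tail t)%:E.
Proof.
rewrite EFinB -gauss_tailE -(@probability_setC _ _ _ (gauss 1)).
  congr (gauss 1 _); apply/seteqP; split => y /=; rewrite in_itv/= andbT => h.
    by apply/negP; rewrite -leNgt.
  by rewrite leNgt; apply/negP.
exact: measurable_itv.
Qed.

End gaussian_tails.

(** * Independent families *)

Section tuples.
Context d (T : measurableType d).

Definition tuple_cons n (z : T * n.-tuple T) : n.+1.-tuple T := [tuple of z.1 :: z.2].

Lemma measurable_tuple_cons n : measurable_fun setT (@tuple_cons n).
Proof. exact: measurable_cons. Qed.

HB.instance Definition _ n :=
  isMeasurableFun.Build _ _ _ _ (@tuple_cons n) (@measurable_tuple_cons n).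

Definition tuple_set n (i : 'I_n) (z : n.-tuple T * T) : n.-tuple T :=
  [tuple if j == i then z.2 else tnth z.1 j | j < n].

Lemma tnth_tuple_set n (i j : 'I_n) z :
  tnth (tuple_set i z) j = if j == i then z.2 else tnth z.1 j.
Proof. by rewrite tnth_mktuple. Qed.

Lemma measurable_tuple_set n (i : 'I_n) : measurable_fun setT (tuple_set i).
Proof.
apply/measurable_fun_tnthP => j; rewrite /comp.
under eq_fun do rewrite tnth_tuple_set.
case: (j == i); first exact: measurable_snd.
exact: (measurableT_comp (measurable_tnth j) measurable_fst).
Qed.

Lemma tuple_set0 n x y (t : n.-tuple T) :
  tuple_set ord0 (tuple_cons (x, t), y) = tuple_cons (y, t).
Proof.
apply: eq_from_tnth => j; rewrite tnth_tuple_set.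
by case: (unliftP ord0 j) => [k ->|->]; rewrite ?tnthS.
Qed.

Lemma tuple_setS n (i : 'I_n) x y (t : n.-tuple T) :
  tuple_set (lift ord0 i) (tuple_cons (x, t), y) = tuple_cons (x, tuple_set i (t, y)).
Proof.
apply: eq_from_tnth => j; rewrite tnth_tuple_set.
case: (unliftP ord0 j) => [k ->|->] //.
by rewrite !tnthS tnth_tuple_set (inj_eq lift_inj).
Qed.

Lemma measurable_forall_tnth n (A : 'I_n -> set T) : (forall i, measurable (A i)) ->
  measurable [set t : n.-tuple T | forall i, A i (tnth t i)].
Proof.
move=> mA; rewrite (_ : mkset _ = \bigcap_(i in [set: 'I_n])
  ((@tnth n T)^~ i @^-1` A i)); last first.
  by apply/seteqP; split=> [t h i _|t h i]; [exact: h|exact: (h i I)].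
apply: fin_bigcap_measurable => // i _.
by rewrite -[X in measurable X]setTI; exact: measurable_tnth.
Qed.

End tuples.

Section iid.
Context d (T : measurableType d) (R : realType) (p : probability T R).
Local Open Scope ereal_scope.

(** Built from two-factor products, so that integrals reduce by induction to Tonelli for two
    measures. *)
Fixpoint iid n : probability (n.-tuple T) R :=
  match n with
  | 0%N => \d_[tuple]
  | m.+1 => distribution (p \x iid m)%E (@tuple_cons _ T m)
  end.

Lemma ge0_integral_iidS n (f : n.+1.-tuple T -> \bar R) :
  measurable_fun setT f -> (forall t, 0 <= f t) ->
  \int[iid n.+1]_t f t = \int[p]_x \int[iid n]_t f (tuple_cons (x, t)).
Proof.
move=> mf f0; rewrite /= ge0_integral_distribution//.
rewrite fubini_tonelli1//.
- exact: measurableT_comp.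
- by move=> z; exact: f0.
Qed.

Lemma iid_setX n (A : 'I_n -> set T) : (forall i, measurable (A i)) ->
  iid n [set t | forall i, A i (tnth t i)] = \prod_(i < n) p (A i).
Proof.
elim: n A => [|n IH] A mA.
  by rewrite /= big_ord0 diracE mem_set// => -[].
rewrite big_ord_recl -IH//= /distribution /pushforward.
rewrite -product_measure1E; [|exact: mA|]; last first.
  by apply: (@measurable_forall_tnth _ _ _ (A \o lift ord0)) => i; exact: mA.
congr (_ _); apply/seteqP; split=> -[x t]/=.
  move=> h; split; first exact: (h ord0).
  by move=> i; have := h (lift ord0 i); rewrite tnthS.
move=> [h1 h2] i; case: (unliftP ord0 i) => [k ->|->] //.
by rewrite tnthS.
Qed.

(** Replacing one coordinate by a fresh independent copy does not change the law. This integrates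
    out an arbitrary coordinate without splitting the tuple at it. *)
Lemma ge0_integral_iid_resample n (i : 'I_n) (f : n.-tuple T -> \bar R) :
  measurable_fun setT f -> (forall t, 0 <= f t) ->
  \int[iid n]_t f t = \int[iid n]_t \int[p]_y f (tuple_set i (t, y)).
Proof.
elim: n i f => [[] //|n IH] i f mf f0.
have mg : measurable_fun setT (fun t => \int[p]_y f (tuple_set i (t, y))).
  apply: (@measurable_fun_fubini_tonelli_F _ _ _ _ R p (f \o tuple_set i)) => //.
    exact: measurableT_comp (measurable_tuple_set i).
  by move=> z; exact: f0.
rewrite (ge0_integral_iidS mf f0) (ge0_integral_iidS mg); last first.
  by move=> t; apply: integral_ge0 => y _; exact: f0.
case: (unliftP ord0 i) => [k ->|->].
  apply: eq_integral => x _; rewrite (IH k); last by move=> t; exact: f0.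
    by apply: eq_integral => t _; apply: eq_integral => y _; rewrite tuple_setS.
  exact/(measurableT_comp mf)/(measurableT_comp (@measurable_tuple_cons _ T n)).
set K := LHS.
(* Resampling coordinate 0 overwrites [x], so the outer integral is that of a constant. *)
transitivity (\int[p]_x cst K x).
  by rewrite integral_cst// [X in _ * X](@probability_setT _ _ _ p) mule1.
apply: eq_integral => x _; rewrite /= /K.
rewrite (fubini_tonelli (f \o @tuple_cons _ T n)).
- by apply: eq_integral => t _; apply: eq_integral => y _; rewrite tuple_set0.
- exact: measurableT_comp.
- by move=> z; exact: f0.
Qed.

End iid.

Section gaussian_vectors.
Context {R : realType}.

Lemma measurable_lin_tuple n (b : 'I_n -> R) :
  measurable_fun setT (fun t : n.-tuple (measurableTypeR R) => \sum_(i < n)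
    b i * tnth t i : R).
Proof.
apply: measurable_sum => i; apply: measurable_funM => //; exact: measurable_tnth.
Qed.

(** Sectioning at the first variable shifts [A] under the law of [Y]; once the outer integral is
    carried to the line along [X], it is [gauss_conv]. *)
Lemma gauss_add d1 d2 (T1 : measurableType d1) (T2 : measurableType d2)
  (P1 : probability T1 R) (P2 : probability T2 R) (X : T1 -> R) (Y : T2 -> R) (q1 q2 : R)
    (A : set R) :
  measurable_fun setT X -> measurable_fun setT Y -> 0 <= q1 -> 0 <= q2 ->
  (forall A, measurable A -> P1 (X @^-1` A) = gauss q1 A) ->
  (forall A, measurable A -> P2 (Y @^-1` A) = gauss q2 A) ->
  measurable A ->
  (P1 \x P2)%E [set z | A (X z.1 + Y z.2)] = gauss (q1 + q2) A.
Proof.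
move=> mX mY q10 q20 PX PY mA.
rewrite -gauss_conv//.
transitivity (\int[P1]_x gauss q2 ((fun y => X x + y)%R @^-1` A))%E.
  apply: eq_integral => x _; rewrite /= -PY.
    by congr (P2 _); apply/seteqP; split => y /=; rewrite /xsection/= ?inE.
  rewrite -[X in measurable X]setTI; apply: (measurable_funD _ _ measurableT mA) => //.
have mX' : measurable_fun setT (X : T1 -> measurableTypeR R) := mX.
rewrite -(@ge0_integral_image_measure _ _ _ (measurableTypeR R)
  _ P1 X mX' _ (measurable_gauss_shift q2 mA))//.
by apply: eq_measure_integral => B mB _; exact: PX.
Qed.

Lemma iid_gauss_lin n (b : 'I_n -> R) A : measurable A ->
  iid (gauss 1) n [set t | A (\sum_(i < n) b i * tnth t i)] = gauss (\sum_(i < n)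
    b i ^+ 2) A.
Proof.
elim: n b A => [|n IH] b A mA.
  have -> : gauss (\sum_(i < 0) b i ^+ 2) A = \d_(0 : R) A by rewrite big_ord0 gaussE eqxx.
  rewrite /= !diracE; congr (_%:R%:E); congr nat_of_bool.
  by apply/idP/idP; rewrite !inE/= big_ord0.
rewrite big_ord_recl/= /distribution /pushforward.
rewrite -(@gauss_add _ _ _ _ (gauss 1) (iid (gauss 1) n) (fun x => b ord0 * x)
  (fun t => \sum_(i < n) b (lift ord0 i) * tnth t i))//.
- have E x (t : n.-tuple R) : \sum_(i < n.+1) b i * tnth (tuple_cons (x, t)) i =
      b ord0 * x + \sum_(i < n) b (lift ord0 i) * tnth t i.
    by rewrite big_ord_recl; congr (_ + _); apply: eq_bigr => i _; rewrite tnthS.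
  by congr (_ _); apply/seteqP; split=> -[x t]/=; rewrite E.
- exact: measurable_funM.
- exact: measurable_lin_tuple.
- exact: sqr_ge0.
- by apply: sumr_ge0 => i _; exact: sqr_ge0.
- by move=> B mB; rewrite -[b ord0 ^+ 2]mulr1; exact: gauss_scale.
- by move=> B mB; exact: (IH (fun i => b (lift ord0 i))).
Qed.

End gaussian_vectors.

(** * Orthant probabilities and linear combinations *)

Lemma bernoulli_ineq (R : realDomainType) (x : R) n : 0 <= x -> 1 + n%:R * x <= (1 + x)
  ^+ n.
Proof.
move=> x0; elim: n => [|n IH]; first by rewrite mul0r addr0 expr0.
rewrite exprS; apply: le_trans (_ : (1 + x) * (1 + n%:R * x) <= _); last first.
  by rewrite ler_wpM2l// addr_ge0.
rewrite -subr_ge0 (_ : _ - _ = n%:R * x * x); first by rewrite !mulr_ge0.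
by rewrite -natr1; ring.
Qed.

(** Bernoulli's inequality combined with [(1 - x) ^+ n * (1 + x) ^+ n <= 1]. *)
Lemma bernoulli_inv_ineq (R : realFieldType) (x : R) n : 0 <= x <= 1 ->
  (1 - x) ^+ n <= (1 + n%:R * x)^-1.
Proof.
move=> /andP[x0 x1]; have h : 0 < 1 + n%:R * x by rewrite ltr_pwDl// mulr_ge0.
rewrite -[leRHS]mul1r ler_pdivlMr//.
apply: le_trans (_ : (1 - x) ^+ n * (1 + x) ^+ n <= _).
  by rewrite ler_wpM2l ?exprn_ge0 ?subr_ge0// bernoulli_ineq.
rewrite -exprMn exprn_ile1//; first by rewrite mulr_ge0 ?subr_ge0// addr_ge0.
by rewrite -subr_ge0 (_ : _ - _ = x * x) ?mulr_ge0//; ring.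
Qed.

Lemma bernoulli_sub_ineq (R : realDomainType) (x : R) n : 0 <= x <= 1 ->
  1 - n%:R * x <= (1 - x) ^+ n.
Proof.
move=> /andP[x0 x1]; elim: n => [|n IH]; first by rewrite mul0r subr0 expr0.
rewrite exprS; apply: le_trans (_ : (1 - x) * (1 - n%:R * x) <= _); last first.
  by rewrite ler_wpM2l// subr_ge0.
rewrite -subr_ge0 (_ : _ - _ = n%:R * x * x); first by rewrite !mulr_ge0.
by rewrite -natr1; ring.
Qed.

(** * Trigonometric approximation of the indicator of a half-line *)

Section smooth_step.
Context {R : realType}.

(* [(1 - t ^ k) ^ (2 ^ k)] tends to [1] for [0 <= t < 1/2] and to [0] for
   [1/2 < t <= 1]; here [t] is a trigonometric polynomial in [z] whose period
   grows with [n], so that the limit is the indicator of [z < 0]. *)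
Definition smooth_step (n : nat) (z : R) : R :=
  (1 - ((1 + sin (z / n.+1%:R)) / 2) ^+ (n.+1 ^ 2)) ^+ (2 ^ (n.+1 ^ 2)).

Lemma sin01 (x : R) : 0 <= (1 + sin x) / 2 <= 1.
Proof. have := sin_le1 x; have := sin_geN1 x; lra. Qed.

Lemma smooth_step_itv n z : 0 <= smooth_step n z <= 1.
Proof.
rewrite /smooth_step; have /andP[a b] := sin01 (z / n.+1%:R).
have h : 0 <= 1 - ((1 + sin (z / n.+1%:R)) / 2) ^+ (n.+1 ^ 2) <= 1.
  by rewrite subr_ge0 exprn_ile1//= lerBlDr lerDl exprn_ge0.
by case/andP : h => h1 h2; rewrite exprn_ge0// exprn_ile1.
Qed.

Lemma sin_near0 : exists2 e : R, 0 < e & forall y, 0 < y < e -> y / 2 <= sin y.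
Proof.
have [_] := @is_derive_sin R 0; rewrite cos0 => d1.
have : (h^-1 *: (sin (h + 0) - sin 0) : R) @[h --> (0:R)^'] --> (1 : R).
  rewrite -d1; have := @ex_derive _ _ _ _ _ _ _ (@is_derive_sin R 0).
  move=> /cvg_ex[l hl]; rewrite /derive.
  under eq_fun do rewrite -[X in sin (X + _)]mulr1.
  by apply/cvg_ex; exists l.
move=> /cvgrPdist_lt/(_ (2^-1)) [|e /= e0 he]; first by rewrite invr_gt0.
exists e => // y /andP[y0 ye].
have := he y; rewrite /= sub0r normrN gtr0_norm// => /(_ ye (lt0r_neq0 y0)).
rewrite addr0 sin0 subr0 /GRing.scale/= => /ltr_normlW h.
have : 2^-1 <= y^-1 * sin y by lra.
by rewrite mulrC ler_pdivlMr// mulrC.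
Qed.

(** With [y] the inner power, [2 ^ k * y] is [(1 - del) ^ k] for [z < 0] and [(1 + del) ^ k] for
    [z > 0]. The exponent [k = m ^ 2] outweighs the slope [1 / m]: [k * del] is at least
    [|z| m / 2]. So [2 ^ k * y] is small in the first case and large in the second, and the
    Bernoulli bounds conclude. At [z = 0] the limit would be [exp (-1)]. *)
Lemma smooth_step_cvg (z : R) : z != 0 -> (fun n => smooth_step n z)
  @ \oo --> ((z < 0)%R%:R : R).
Proof.
move=> z0; have [e e0 he] := sin_near0.
have az : 0 < `|z| by rewrite normr_gt0.
apply/cvgrPdist_le => eps eps0.
near=> n.
pose m : R := n.+1%:R; have m0 : 0 < m by rewrite ltr0n.
pose del := sin (`|z| / m).
have dlb : `|z| / m / 2 <= del.
  apply: he; rewrite divr_gt0//= ltr_pdivrMr// mulrC -ltr_pdivrMr//.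
  by rewrite /m -natr1 ltr_wpDr//; near: n; exact: nbhs_infty_gtr.
have d0 : 0 <= del by apply: le_trans dlb; rewrite !divr_ge0// ltW.
have d1 : del <= 1 := sin_le1 _.
pose k := (n.+1 ^ 2)%N.
have kd : `|z| * m / 2 <= k%:R * del.
  apply: le_trans (_ : k%:R * (`|z| / m / 2) <= _); last by rewrite ler_wpM2l.
  by rewrite /k natrX -/m le_eqVlt; apply/orP; left; apply/eqP; field; rewrite gt_eqF.
have kd0 : 0 < k%:R * del by apply: lt_le_trans kd; rewrite divr_gt0// mulr_gt0.
have small : (1 + k%:R * del)^-1 <= eps.
  rewrite -[leRHS]invrK lef_pV2 ?posrE ?invr_gt0// ?ltr_pwDl// ?(ltW kd0)//.
  apply: (@le_trans _ _ (`|z| * m / 2)); last by lra.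
  rewrite ler_pdivlMr// mulrC -ler_pdivrMl//.
  by rewrite /m -(natr1 n) ler_wpDr//; near: n; exact: nbhs_infty_ger.
apply: le_trans small; rewrite /smooth_step -/m -/k.
have [zlt|zge] := ltP z 0.
  have -> : sin (z / m) = - del.
    by rewrite /del ltr0_norm// mulNr sinN opprK.
  set y := (X in (1 - X) ^+ _).
  have y01 : 0 <= y <= 1.
    rewrite /y; have h : 0 <= (1 - del) / 2 <= 1 by lra.
    by case/andP : h => h1 h2; rewrite exprn_ge0// exprn_ile1.
  have ub : (1 - y) ^+ (2 ^ k) <= 1 by case/andP: y01 => a b;
    rewrite exprn_ile1// ?subr_ge0// gerBl.
  rewrite ger0_norm ?subr_ge0//.
  apply: (@le_trans _ _ (2 ^+ k * y)).
    rewrite lerBlDr -lerBlDl -natrX; exact: bernoulli_sub_ineq.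
  rewrite /y expr_div_n mulrC divfK ?expf_neq0//.
  by apply: bernoulli_inv_ineq; rewrite d0.
have zgt : 0 < z by rewrite lt_neqAle eq_sym z0.
have -> : sin (z / m) = del by rewrite /del gtr0_norm.
rewrite sub0r normrN.
set y := (X in (1 - X) ^+ _).
have y01 : 0 <= y <= 1.
  rewrite /y; have h : 0 <= (1 + del) / 2 <= 1 by lra.
  by case/andP : h => h1 h2; rewrite exprn_ge0// exprn_ile1.
rewrite ger0_norm; last by case/andP: y01 => a b; rewrite exprn_ge0// subr_ge0.
apply: (le_trans (bernoulli_inv_ineq _ y01)).
have yE : (2 ^ k)%:R * y = (1 + del) ^+ k.
  by rewrite natrX /y expr_div_n mulrC divfK ?expf_neq0.
have := bernoulli_ineq k d0 => hb.
rewrite lef_pV2 ?posrE; last 2 first.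
- by rewrite yE; apply: ltr_wpDr => //; rewrite exprn_ge0// addr_ge0.
- by rewrite ltr_pwDl// ltW.
by rewrite yE; apply: (le_trans hb); rewrite lerDr.
Unshelve. all: by end_near. Qed.

End smooth_step.

Lemma bounded_integrable d (T : measurableType d) (R : realType) (P : probability T R)
    (f : T -> R) (M : R) : measurable_fun setT f -> (forall t, `|f t| <= M) ->
  P.-integrable setT (EFin \o f).
Proof.
move=> mf fM; apply: measurable_bounded_integrable => //.
  by rewrite [X in (X < _)%E](@probability_setT _ _ _ P) ltry.
exists M; split; first exact: num_real.
by move=> x Mx t _ /=; apply: (le_trans (fM t)); exact: ltW.
Qed.

Lemma measurable_cos (R : realType) : measurable_fun setT (@cos R).
Proof. by apply: continuous_measurable_fun; exact: continuous_cos. Qed.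

Section trigonometric_polynomials.
Context {R : realType} (I : finType).
Implicit Types (f g : (I -> R) -> R) (a b : I -> R) (c : R).

Definition dot a (x : I -> R) := \sum_i a i * x i.

(** Each generator depends on a single linear form, so its mean is fixed by the law of that form.
    The free phase [e] brings in sines as well. *)
Inductive trig_poly : ((I -> R) -> R) -> Prop :=
| trig_poly_cos a c e : trig_poly (fun x => c * cos (dot a x + e))
| trig_poly_add f g : trig_poly f -> trig_poly g -> trig_poly (fun x => f x + g x).

Lemma dotD a b x : dot (fun i => a i + b i) x = dot a x + dot b x.
Proof. by rewrite /dot -big_split/=; apply: eq_bigr => i _; rewrite mulrDl. Qed.

Lemma dotB a b x : dot (fun i => a i - b i) x = dot a x - dot b x.
Proof. by rewrite /dot -sumrB; apply: eq_bigr => i _; rewrite mulrBl. Qed.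

Lemma trig_poly_ext f g : f =1 g -> trig_poly f -> trig_poly g.
Proof. by move=> /funext ->. Qed.

Lemma trig_poly_cst c : trig_poly (fun=> c).
Proof.
apply: (trig_poly_ext _ (trig_poly_cos (fun=> 0) c 0)) => x.
by rewrite /dot big1 ?addr0 ?cos0 ?mulr1// => i _; rewrite mul0r.
Qed.

(** Product-to-sum: [cos A cos B] is half of [cos (A + B) + cos (A - B)], and [dot] is additive in
    its coefficients. *)
Lemma trig_poly_mul f g : trig_poly f -> trig_poly g -> trig_poly (fun x => f x * g x).
Proof.
move=> tf; elim: tf g => [a c e|f1 f2 _ IH1 _ IH2] g tg; last first.
  apply: (trig_poly_ext _ (trig_poly_add (IH1 _ tg) (IH2 _ tg))) => x.
  by rewrite mulrDl.
elim: tg => [b c' e'|g1 g2 _ IH1 _ IH2]; last first.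
  by apply: (trig_poly_ext _ (trig_poly_add IH1 IH2)) => x; rewrite mulrDr.
apply: (trig_poly_ext _ (trig_poly_add
  (trig_poly_cos (fun i => a i + b i) (c * c' / 2) (e + e'))
  (trig_poly_cos (fun i => a i - b i) (c * c' / 2) (e - e')))) => x.
rewrite dotD dotB addrACA (_ : dot a x - dot b x + (e - e') = (dot a x + e)
  - (dot b x + e')); last by ring.
by rewrite cosD cosB; field.
Qed.

Lemma trig_poly_exp f n : trig_poly f -> trig_poly (fun x => f x ^+ n).
Proof.
move=> tf; elim: n => [|n IH].
  by apply: (trig_poly_ext _ (trig_poly_cst 1)) => x; rewrite expr0.
by apply: (trig_poly_ext _ (trig_poly_mul tf IH)) => x; rewrite exprS.
Qed.

Lemma trig_poly_prod (F : I -> (I -> R) -> R) (s : seq I) : (forall i, trig_poly (F i)) ->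
  trig_poly (fun x => \prod_(i <- s) F i x).
Proof.
move=> tF; elim: s => [|i s IH].
  by apply: (trig_poly_ext _ (trig_poly_cst 1)) => x; rewrite big_nil.
by apply: (trig_poly_ext _ (trig_poly_mul (tF i) IH)) => x; rewrite big_cons.
Qed.

Lemma trig_poly_sin (i : I) (w u : R) : trig_poly (fun x => sin (w * (x i - u))).
Proof.
apply: (trig_poly_ext _ (trig_poly_cos (fun j => (j == i)%:R * w) 1 (- (w * u)
  - pi / 2))) => x.
rewrite mul1r /dot (bigD1 i)//= eqxx mul1r big1 ?addr0; last first.
  by move=> j /negbTE ->; rewrite !mul0r.
by rewrite addrA -mulrBr cosB cos_pihalf mulr0 sin_pihalf mulr1 add0r.
Qed.

Lemma trig_poly_smooth_step n (i : I) (u : R)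
  : trig_poly (fun x => smooth_step n (x i - u)).
Proof.
have tB f : trig_poly f -> trig_poly (fun x => 1 - f x).
  move=> tf; apply: (trig_poly_ext _ (trig_poly_add (trig_poly_cst 1)
    (trig_poly_mul (trig_poly_cst (-1)) tf))) => x.
  by rewrite mulN1r.
apply/trig_poly_exp/tB/trig_poly_exp.
apply: (trig_poly_ext _ (trig_poly_mul (trig_poly_cst 2^-1)
  (trig_poly_add (trig_poly_cst 1) (trig_poly_sin i n.+1%:R^-1 u)))) => x.
by rewrite mulrC (mulrC n.+1%:R^-1).
Qed.

End trigonometric_polynomials.

(** * Laws of linear combinations determine orthant probabilities *)

Section cramer_wold.
Context {R : realType} (I : finType).
Context d1 d2 (T1 : measurableType d1) (T2 : measurableType d2).
Variables (P1 : probability T1 R) (P2 : probability T2 R).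
Variables (X : I -> T1 -> R) (Y : I -> T2 -> R).
Hypothesis mX : forall i, measurable_fun setT (X i).
Hypothesis mY : forall i, measurable_fun setT (Y i).
Hypothesis XY : forall (a : I -> R) (A : set R), measurable A ->
  P1 [set t | A (\sum_i a i * X i t)] = P2 [set t | A (\sum_i a i * Y i t)].

Lemma integral_same_law (L1 : T1 -> R) (L2 : T2 -> R) (phi : R -> R) (M : R) :
  measurable_fun setT L1 -> measurable_fun setT L2 ->
  (forall A : set R, measurable A -> P1 (L1 @^-1` A) = P2 (L2 @^-1` A)) ->
  measurable_fun setT phi -> (forall x, `|phi x| <= M) ->
  (\int[P1]_t (phi (L1 t))%:E = \int[P2]_t (phi (L2 t))%:E)%E.
Proof.
move=> mL1 mL2 L12 mphi bphi.
have mE : measurable_fun setT (EFin \o phi) by exact/measurable_EFinP.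
transitivity (\int[image_measure P1 mL1]_x (EFin \o phi) x)%E.
  rewrite (integral_pushforward mL1)//.
  by apply: (@bounded_integrable _ _ _ _ _ M) => //; exact: measurableT_comp.
transitivity (\int[image_measure P2 mL2]_x (EFin \o phi) x)%E; last first.
  rewrite (integral_pushforward mL2)//.
  by apply: (@bounded_integrable _ _ _ _ _ M) => //; exact: measurableT_comp.
by apply: eq_measure_integral => A mA _; exact: L12.
Qed.

Lemma measurable_dot d (T : measurableType d) (Z : I -> T -> R) (a : I -> R) :
  (forall i, measurable_fun setT (Z i)) ->
  measurable_fun setT (fun t => dot a (Z^~ t)).
Proof. by move=> mZ; apply: measurable_sum => i; exact: measurable_funM. Qed.

Lemma integrable_trig_poly d (T : measurableType d) (P : probability T R)
  (Z : I -> T -> R) f :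
  (forall i, measurable_fun setT (Z i)) -> trig_poly f ->
  P.-integrable setT (EFin \o (fun t => f (Z^~ t))).
Proof.
move=> mZ; elim => [a c e|g h _ IHg _ IHh]; last first.
  have := integrableD measurableT IHg IHh; apply: eq_integrable => //.
apply: (@bounded_integrable _ _ _ _ _ `|c|).
  apply: measurable_funM => //; apply: measurableT_comp.
    exact: measurable_cos.
  apply: measurable_funD => //; exact: measurable_dot.
by move=> t; rewrite normrM ler_piMr// cos_max.
Qed.

Lemma integral_trig_poly f : trig_poly f ->
  (\int[P1]_t (f (X^~ t))%:E = \int[P2]_t (f (Y^~ t))%:E)%E.
Proof.
elim => [a c e|g h tg IHg th IHh]; last first.
  under eq_integral do rewrite EFinD.
  under [RHS]eq_integral do rewrite EFinD.
  rewrite !integralD//; try exact: integrable_trig_poly.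
  by rewrite IHg IHh.
apply: (@integral_same_law _ _ (fun y => c * cos (y + e)) `|c|).
- exact: measurable_dot.
- exact: measurable_dot.
- by move=> A mA; exact: XY.
- apply: measurable_funM => //; apply: measurableT_comp.
    exact: measurable_cos.
  exact: measurable_funD.
- by move=> t; rewrite normrM ler_piMr// cos_max.
Qed.

(** Dominated convergence. The absence of atoms at [u i] discards the points where a factor is
    evaluated at 0, the only place where [smooth_step] does not converge to the indicator. *)
Lemma orthant_cvg d (T : measurableType d) (P : probability T R) (Z : I -> T -> R)
  (u : I -> R) :
  (forall i, measurable_fun setT (Z i)) ->
  (forall i, P [set t | Z i t = u i] = 0%E) ->
  (fun n => \int[P]_t (\prod_i smooth_step n (Z i t - u i))%:E)%E @ \oo -->
    P [set t | forall i, Z i t <= u i].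
Proof.
move=> mZ Z0.
set A := mkset _.
have mA : measurable A.
  rewrite (_ : A = \bigcap_(i in [set: I]) (Z i @^-1` `]-oo, u i]%classic)); last first.
    apply/seteqP; split=> [t h i _|t h i]; first by rewrite /= in_itv/=; exact: h.
    by have := h i Logic.I; rewrite /= in_itv/=.
  apply: fin_bigcap_measurable => // i _.
  by rewrite -[X in measurable X]setTI; exact: mZ.
rewrite -[A]setIT -integral_indic//.
pose f_ n t := (\prod_i smooth_step n (Z i t - u i))%:E.
have tf n : trig_poly (fun x : I -> R => \prod_i smooth_step n (x i - u i)).
  by apply: trig_poly_prod => i; exact: trig_poly_smooth_step.
have [] := @dominated_convergence _ _ _ P setT measurableT f_ (EFin \o \1_A) (cst 1%E).
- by move=> n; exact: (measurable_int _ (integrable_trig_poly P mZ (tf n))).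
- exact/measurable_EFinP.
- have h : {ae P, forall t, forall i, Z i t <> u i}.
    apply: filter_forall => i; exists [set t | Z i t = u i]; split => //.
      rewrite (_ : mkset _ = Z i @^-1` [set u i])//.
      by rewrite -[X in measurable X]setTI; exact: mZ.
    by move=> t /= /contrapT.
  apply: filterS h => t h _.
  have zn i : Z i t - u i != 0 by rewrite subr_eq0; apply/eqP; exact: h.
  apply: cvg_EFin; first by near=> n.
  rewrite /comp/=.
  have -> : \1_A t = \prod_i (Z i t - u i < 0)%R%:R :> R.
    rewrite indicE; have [At|nAt] := pselect (A t).
      rewrite mem_set// big1// => i _; rewrite lt_neqAle zn/= subr_le0.
      by have -> := At i.
    rewrite memNset//; have /existsNP[i hi] := nAt.
    rewrite (bigD1 i)//= (_ : (_ < 0) = false) ?mul0r//.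
    by rewrite subr_lt0; apply/negbTE; apply/negP => /ltW.
  (* A finite product of limits, by induction on the list that enumerates [I]. *)
  rewrite /index_enum; elim: (Finite.enum _) => [|i s IH].
    by under eq_fun do rewrite big_nil; rewrite big_nil; exact: cvg_cst.
  under eq_fun do rewrite big_cons; rewrite big_cons.
  by apply: cvgM; [exact: smooth_step_cvg|exact: IH].
- exact: finite_measure_integrable_cst.
- apply: aeW => t n _; rewrite lee_fin ger0_norm.
    by apply: prodr_ile1 => i _; exact: smooth_step_itv.
  by apply: prodr_ge0 => i _; case/andP: (smooth_step_itv n (Z i t - u i)).
- by move=> _ _.
Unshelve. all: by end_near. Qed.

(** The approximants of the two sides have equal means for every [n], hence equal limits.
    Combinations with one nonzero coefficient transfer the absence of atoms from [X] to [Y]. *)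
Lemma cramer_wold_orthant (u : I -> R) :
  (forall i, P1 [set t | X i t = u i] = 0%E) ->
  P1 [set t | forall i, X i t <= u i] = P2 [set t | forall i, Y i t <= u i].
Proof.
move=> X0.
have Y0 i : P2 [set t | Y i t = u i] = 0%E.
  have := XY (fun j => (j == i)%:R) (measurable_set1 (u i)).
  have E T (Z : I -> T -> R) : [set t | [set u i] (\sum_j (j == i)%:R * Z j t)] = [set t
    | Z i t = u i].
    apply/seteqP; split => t /=; rewrite (bigD1 i)//= eqxx mul1r big1 ?addr0// => j
      /negbTE ->;
     by rewrite mul0r.
  by rewrite !E X0.
have hX := orthant_cvg mX X0.
have hY := orthant_cvg mY Y0.
apply: (@cvg_unique _ (@ereal_hausdorff R) _ _ _ _ hX).
move: hY; apply: cvg_trans; apply: near_eq_cvg; near=> n.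
apply: esym; apply: (@integral_trig_poly (fun x => \prod_i smooth_step n (x i - u i))).
by apply: trig_poly_prod => i; exact: trig_poly_smooth_step.
Unshelve. all: by end_near. Qed.

End cramer_wold.

(** * The pair field *)

Section pair_field.
Context {R : realType} (n : nat).
Local Notation pair := ('I_n * 'I_n)%type.
Implicit Types (p s : pair) (r : R).

Definition incident (m : 'I_n) p : R := (m \in [set p.1; p.2]%SET)%:R.

Lemma incident_sum p (z : 'I_n -> R) : (p.1 < p.2)%N ->
  \sum_m incident m p * z m = z p.1 + z p.2.
Proof.
move=> h; have hn : p.2 != p.1 by apply: contraTneq h => ->; rewrite ltnn.
rewrite (bigD1 p.1)//= (bigD1 p.2)//= big1 ?addr0; last first.
  move=> m /andP[m1 m2]; rewrite /incident !inE (negbTE m1) (negbTE m2) mul0r//.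
by rewrite /incident !inE !eqxx orbT !mul1r.
Qed.

(** The incidence vectors have as scalar product the number of common indices. For equal pairs this
    gives [2 * r], and the diagonal term restores the variance 1. *)
Lemma pair_covE r p s : (p.1 < p.2)%N -> (s.1 < s.2)%N ->
  pair_cov r p.1 p.2 s.1 s.2 =
  r * \sum_m incident m p * incident m s + (1 - 2 * r) * (p == s)%:R.
Proof.
case: p s => [i j] [k l]/= ij kl.
have -> : \sum_m incident m (i, j) * incident m (k, l) = #|[set i; j]%SET :&: [set k;
  l]%SET|%:R.
  rewrite -sum1_card natr_sum [RHS]big_mkcond/=; apply: eq_bigr => m _.
  by rewrite inE /incident/=; case: (m \in [set i; j]%SET); case: (m \in [set k; l]%SET);
    rewrite ?mul1r ?mul0r.
rewrite /pair_cov.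
have cij : #|[set i; j]%SET| = 2%N by rewrite cards2; case: eqP ij => // ->; rewrite ltnn.
have ckl : #|[set k; l]%SET| = 2%N by rewrite cards2; case: eqP kl => // ->; rewrite ltnn.
have le2 : (#|[set i; j]%SET :&: [set k;
  l]%SET| <= 2)%N by rewrite -cij subset_leq_card// finset.subsetIl.
have [e|ne] := eqVneq (i, j) (k, l).
  by case: e => -> ->; rewrite finset.setIid ckl/=; ring.
have : #|[set i; j]%SET :&: [set k; l]%SET| != 2%N.
  (* Two common elements make the two-element sets equal, and then the order of the indices makes
     the pairs equal. *)
  apply: contra ne => /eqP c2.
  have e1 : [set i; j]%SET :&: [set k; l]%SET = [set i; j]%SET.
    by apply/eqP; rewrite eqEcard finset.subsetIl cij c2.
  have e2 : [set i; j]%SET :&: [set k; l]%SET = [set k; l]%SET.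
    by apply/eqP; rewrite eqEcard finset.subsetIr ckl c2.
  have e : [set i; j]%SET = [set k; l]%SET by rewrite -e1 e2.
  have : i \in [set k; l]%SET by rewrite -e !inE eqxx.
  have : j \in [set k; l]%SET by rewrite -e !inE eqxx orbT.
  have : k \in [set i; j]%SET by rewrite e !inE eqxx.
  rewrite !inE => /orP[]/eqP ki; subst k.
    move=> /orP[/eqP ji|/eqP jl _]; first by move: ij; rewrite ji ltnn.
    by rewrite jl eqxx.
  move=> _ /orP[/eqP e3|/eqP e3]; move: ij; first by rewrite e3 ltnn.
  by rewrite e3 ltnNge (ltnW kl).
by move: le2; case: #|_| => [|[|[|]]]//=; rewrite ?mulr0 ?addr0 ?mulr1.
Qed.

Lemma pair_quadE (C : 'I_n -> 'I_n -> 'I_n -> 'I_n -> R) (a : 'I_n -> 'I_n -> R) :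
  pair_quad C a = \sum_(p : pair | (p.1 < p.2)%N) \sum_(s : pair | (s.1 < s.2)%N)
    a p.1 p.2 * a s.1 s.2 * C p.1 p.2 s.1 s.2.
Proof.
rewrite /pair_quad pair_big_dep/=; apply: eq_bigr => p _.
by rewrite pair_big_dep.
Qed.

Lemma lin_combE T (a : 'I_n -> 'I_n -> R) (X : 'I_n -> 'I_n -> T -> R) t :
  lin_comb a X t = \sum_(p : pair | (p.1 < p.2)%N) a p.1 p.2 * X p.1 p.2 t.
Proof. by rewrite /lin_comb pair_big_dep. Qed.

(** A sum of squares with weights [r] and [1 - 2 * r], nonnegative for [0 <= r <= 1/2]: the first
    comes from one variable per index, the second from one variable per pair. *)
Lemma pair_quad_pair_cov r (a : 'I_n -> 'I_n -> R) :
  pair_quad (pair_cov r) a =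
  r * (\sum_m (\sum_(p : pair | (p.1 < p.2)%N) a p.1 p.2 * incident m p) ^+ 2) +
  (1 - 2 * r) * \sum_(p : pair | (p.1 < p.2)%N) a p.1 p.2 ^+ 2.
Proof.
rewrite pair_quadE.
transitivity (\sum_(p : pair | (p.1 < p.2)%N) \sum_(s : pair | (s.1 < s.2)%N)
   (r * (\sum_m (a p.1 p.2 * incident m p) * (a s.1 s.2 * incident m s))
   + (1 - 2 * r) * (a p.1 p.2 * (a s.1 s.2 * (p == s)%:R)))).
  apply: eq_bigr => p hp; apply: eq_bigr => s hs; rewrite pair_covE// mulrDr; congr (_ + _).
    rewrite mulrCA; congr (_ * _); rewrite mulr_sumr; apply: eq_bigr => m _; ring.
  ring.
under eq_bigr do rewrite big_split/= -!mulr_sumr.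
rewrite big_split/= -!mulr_sumr; congr (_ * _ + _ * _).
  rewrite (eq_bigr (fun p => \sum_m \sum_(s : pair | (s.1 < s.2)%N)
    a p.1 p.2 * incident m p * (a s.1 s.2 * incident m s))); last first.
    by move=> p _; rewrite exchange_big.
  rewrite exchange_big/=; apply: eq_bigr => m _.
  rewrite expr2 mulr_suml; apply: eq_bigr => p _.
  by rewrite mulr_sumr.
apply: eq_bigr => p hp; rewrite (bigD1 p)//= eqxx mulr1 big1 ?addr0 ?expr2//.
by move=> s /andP[_ /negbTE sp]; rewrite eq_sym sp mulr0.
Qed.

Lemma big_mxvec_index (T : Type) (idx : T) (op : Monoid.com_law idx) (F : 'I_(n * n) -> T) :
  \big[op/idx]_k F k = \big[op/idx]_(p : pair) F (mxvec_index p.1 p.2).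
Proof.
rewrite (reindex _ (curry_mxvec_bij n n)).
by apply: eq_bigr => -[i j] _.
Qed.

Local Notation vec m := (m.-tuple (measurableTypeR R)).

(** The pair variables form a tuple of length [n * n], since [iid] is indexed by ordinals and
    [mxvec_index] is a bijection from all ordered pairs. *)
Definition model r p (z : vec n * vec (n * n)) : R :=
  Num.sqrt r * (tnth z.1 p.1 + tnth z.1 p.2) +
  Num.sqrt (1 - 2 * r) * tnth z.2 (mxvec_index p.1 p.2).

Lemma measurable_model r p : measurable_fun setT (model r p).
Proof.
apply: measurable_funD; apply: measurable_funM => //.
  by apply: measurable_funD;
    exact: (measurableT_comp (measurable_tnth _) measurable_fst).
exact: (measurableT_comp (measurable_tnth _) measurable_snd).
Qed.

Definition model_prob := (iid (@gauss R 1) n \x iid (@gauss R 1) (n * n))%E.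

Lemma model_lin r (a : 'I_n -> 'I_n -> R) A : 0 <= r <= 1 / 2 -> measurable A ->
  model_prob [set z | A (\sum_(p : pair | (p.1 < p.2)%N) a p.1 p.2 * model r p z)] =
  gauss (pair_quad (pair_cov r) a) A.
Proof.
move=> /andP[r0 r1] mA.
have e0 : 0 <= 1 - 2 * r by lra.
(* [b] and [c] are the coefficients of the index variables and of the pair variables. The argument
   of [c] is an ordinal, so a Kronecker sum finds its pair. *)
pose b m := Num.sqrt r * \sum_(p : pair | (p.1 < p.2)%N) a p.1 p.2 * incident m p.
pose c (k : 'I_(n * n)) := Num.sqrt (1 - 2 * r) * \sum_(p : pair | (p.1 < p.2)%N)
  a p.1 p.2 * (mxvec_index p.1 p.2 == k)%:R.
have cE p : c (mxvec_index p.1 p.2) = Num.sqrt (1 - 2 * r)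
  * (if (p.1 < p.2)%N then a p.1 p.2 else 0).
  congr (_ * _); rewrite big_mkcond/= (bigD1 p)//= eqxx mulr1 big1 ?addr0// => s sp.
  case: ifP => // _; rewrite (_ : (_ == _) = false) ?mulr0//.
  apply/negbTE; apply: contra sp => /eqP e.
  have := congr1 (fun k => enum_val (cast_ord (esym (mxvec_cast n n)) k)) e.
  by rewrite /mxvec_index !cast_ordK !enum_rankK -!surjective_pairing => ->.
have linE z : \sum_(p : pair | (p.1 < p.2)%N) a p.1 p.2 * model r p z =
    \sum_m b m * tnth z.1 m + \sum_k c k * tnth z.2 k.
  rewrite (big_mxvec_index _ (fun k => c k * tnth z.2 k)).
  under [X in _ = _ + X]eq_bigr do rewrite cE.
  rewrite [X in _ = _ + X](_ : _ = \sum_(p : pair | (p.1 < p.2)%N)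
     a p.1 p.2 * (Num.sqrt (1 - 2 * r) * tnth z.2 (mxvec_index p.1 p.2))); last first.
    rewrite [RHS]big_mkcond/=; apply: eq_bigr => p _.
    by case: ifP => _; rewrite ?mulr0 ?mul0r//; ring.
  rewrite [X in _ = X + _](_ : _ = \sum_(p : pair | (p.1 < p.2)%N)
     a p.1 p.2 * (Num.sqrt r * (tnth z.1 p.1 + tnth z.1 p.2))); last first.
    under eq_bigr do rewrite -mulrA mulr_suml mulr_sumr.
    rewrite exchange_big/=; apply: eq_bigr => p hp.
    rewrite -(incident_sum (fun m => tnth z.1 m) hp) 2!mulr_sumr; apply: eq_bigr => m _;
      ring.
  by rewrite -big_split/=; apply: eq_bigr => p _; rewrite -mulrDr.
have qE : pair_quad (pair_cov r) a = \sum_m b m ^+ 2 + \sum_k c k ^+ 2.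
  rewrite pair_quad_pair_cov mulr_sumr; congr (_ + _).
    by apply: eq_bigr => m _; rewrite exprMn sqr_sqrtr.
  rewrite (big_mxvec_index _ (fun k => c k ^+ 2)) mulr_sumr big_mkcond/=.
  apply: eq_bigr => p _; rewrite cE exprMn sqr_sqrtr//.
  by case: ifP => //; rewrite expr0n/= mulr0.
rewrite qE -(@gauss_add _ _ _ _ _ (iid (gauss 1) n) (iid (gauss 1) (n * n))
  (fun t => \sum_(i < n) b i * tnth t i) (fun t => \sum_(k < n * n) c k * tnth t k))//.
- by congr (_ _); apply/seteqP; split => z /=; rewrite linE.
- exact: measurable_lin_tuple.
- exact: measurable_lin_tuple.
- by apply: sumr_ge0 => i _; exact: sqr_ge0.
- by apply: sumr_ge0 => i _; exact: sqr_ge0.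
- by move=> B mB; exact: iid_gauss_lin.
- by move=> B mB; exact: iid_gauss_lin.
Qed.

(** [r < 1 / 2] makes the variance of each coordinate positive, so that no coordinate has an atom at
    [u], as [cramer_wold_orthant] demands. *)
Lemma orthant_model d (T : measurableType d) (P : probability T R)
    (X : 'I_n -> 'I_n -> T -> R) r (u : R) : 0 <= r -> r < 1 / 2 ->
  centered_gaussian_field P (pair_cov r) X ->
  P [set t | forall p : pair, (p.1 < p.2)%N -> X p.1 p.2 t <= u] =
  model_prob [set z | forall p : pair, (p.1 < p.2)%N -> model r p z <= u].
Proof.
move=> r0 r1 [mX lawX].
have r01 : 0 <= r <= 1 / 2 by rewrite r0 ltW.
(* The pairs [i >= j] get the constant value [0] and the threshold [1]. *)
pose X' p t := if (p.1 < p.2)%N then X p.1 p.2 t else 0.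
pose Y' p z := if (p.1 < p.2)%N then model r p z else 0.
pose u' p : R := if (p.1 < p.2)%N then u else 1.
have sumE S (V : pair -> S -> R) (a : pair -> R) t :
    \sum_p a p * (if (p.1 < p.2)%N then V p t else 0) =
    \sum_(p : pair | (p.1 < p.2)%N) a p * V p t.
  by rewrite [RHS]big_mkcond/=; apply: eq_bigr => p _; case: ifP; rewrite ?mulr0.
have XY (a : pair -> R) (A : set R) : measurable A ->
    P [set t | A (\sum_p a p * X' p t)] = model_prob [set t | A (\sum_p a p * Y' p t)].
  move=> mA; have := lawX (fun i j => a (i, j)) A mA; rewrite /= -gaussE.
  rewrite -model_lin//.
  have eX t : \sum_p a p * X' p t = lin_comb (fun i j => a (i, j)) X t.
    rewrite (sumE _ (fun p => X p.1 p.2)) lin_combE.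
    by apply: eq_bigr => p _; rewrite -surjective_pairing.
  have eY t : \sum_p a p * Y' p t = \sum_(p : pair | (p.1 < p.2)%N) a (p.1, p.2)
    * model r p t.
    rewrite (sumE _ (model r)).
    by apply: eq_bigr => p _; rewrite -surjective_pairing.
  move=> h; transitivity (P (lin_comb (fun i j => a (i, j)) X @^-1` A)).
    by congr (P _); apply/seteqP; split => t /=; rewrite eX.
  by rewrite h; congr (model_prob _); apply/seteqP; split => t /=; rewrite eY.
have := @cramer_wold_orthant R pair _ _ _ _ P model_prob X' Y' _ _ XY u'.
have mX' p : measurable_fun setT (X' p).
  by rewrite /X'; case: (boolP (p.1 < p.2)%N) => h; [exact: mX|exact: measurable_cst].
have mY' p : measurable_fun setT (Y' p).
  by rewrite /Y'; case: (boolP (p.1 < p.2)%N) => h;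
    [exact: measurable_model|exact: measurable_cst].
have orthE S (V : pair -> S -> R) :
    [set t | forall p : pair, (if (p.1 < p.2)%N then V p t else 0) <= u' p] =
    [set t | forall p : pair, (p.1 < p.2)%N -> V p t <= u].
  apply/seteqP; split => t /= h p; rewrite /u'; first by move=> hp; have := h p;
    rewrite /u' hp.
  by case: ifP => // hp; exact: h.
rewrite (orthE _ (fun p => X p.1 p.2)) (orthE _ (model r)); move=> h; apply: h => // p.
rewrite /X' /u'; case: (boolP (p.1 < p.2)%N) => hp; last first.
  by rewrite (_ : mkset _ = set0)//; apply/seteqP; split => t //= /eqP;
    rewrite eq_sym oner_eq0.
pose a (i j : 'I_n) : R := ((i, j) == p)%:R.
have := lawX a [set u] (measurable_set1 u); rewrite /= -gaussE.
have -> : lin_comb a X @^-1` [set u] = [set t | X p.1 p.2 t = u].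
  have E t : lin_comb a X t = X p.1 p.2 t.
    rewrite lin_combE (bigD1 p)//= /a -surjective_pairing eqxx mul1r big1 ?addr0//.
    by move=> s /andP[_ /negbTE sp]; rewrite -surjective_pairing sp mul0r.
  by apply/seteqP; split => t /=; rewrite E.
move=> ->.
have q0 : 0 < pair_quad (pair_cov r) a.
  rewrite pair_quad_pair_cov; apply: ltr_wpDl.
    by rewrite mulr_ge0// sumr_ge0// => m _; exact: sqr_ge0.
  rewrite mulr_gt0//; first by lra.
  rewrite (bigD1 p)//= /a -surjective_pairing eqxx expr1n ltr_pwDl// sumr_ge0//.
rewrite gaussE gt_eqF//; apply: (@integral_Sset1 _ _ _ u) => //.
Qed.

(** The conditional probability that a pair exceeds [u] when its two index variables are [z] and
    [w], the [q] of the overview. *)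
Definition cond_tail r (u z w : R) : R :=
  gauss_tail ((u - Num.sqrt r * (z + w)) / Num.sqrt (1 - 2 * r)).

Lemma model_orthant r u : 0 <= r -> r < 1 / 2 ->
  model_prob [set z | forall p : pair, (p.1 < p.2)%N -> model r p z <= u] =
  (\int[iid (gauss 1) n]_t (\prod_(p : pair | (p.1 < p.2)%N)
      (1 - cond_tail r u (tnth t p.1) (tnth t p.2)))%:E)%E.
Proof.
move=> r0 r1; apply: eq_integral => t _ /=.
have e0 : 0 < Num.sqrt (1 - 2 * r) by rewrite sqrtr_gt0; lra.
pose th p := (u - Num.sqrt r * (tnth t p.1 + tnth t p.2)) / Num.sqrt (1 - 2 * r).
(* For a fixed value of the index variables the event is a product of half-lines; the positions with
   [i >= j] get [setT] and contribute a factor 1. *)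
pose A (k : 'I_(n * n)) : set (measurableTypeR R) :=
  if ((enum_val (cast_ord (esym (mxvec_cast n n))
    k)).1 < (enum_val (cast_ord (esym (mxvec_cast n n)) k)).2)%N
  then [set y : R | y <= th (enum_val (cast_ord (esym (mxvec_cast n n)) k))] else setT.
have AE (p : pair) : A (mxvec_index p.1 p.2)
  = if (p.1 < p.2)%N then [set y : R | y <= th p] else setT.
  by rewrite /A /mxvec_index cast_ordK enum_rankK -surjective_pairing.
have mA k : measurable (A k).
  rewrite /A; case: ifP => _; last exact: measurableT.
  exact: measurable_itv `]-oo, _].
transitivity (iid (gauss 1) (n * n) [set w | forall k, A k (tnth w k)]).
  congr (iid _ _ _); apply/seteqP; split => w /=; rewrite /xsection/= ?inE/=.
    move=> h k; case/mxvec_indexP: k => i j; rewrite (AE (i, j)).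
    case: ifPn => //= ij; have := h (i, j) ij.
    by rewrite /model/= -lerBrDl ler_pdivlMr// mulrC.
  move=> h p hp; have := h (mxvec_index p.1 p.2); rewrite AE hp/=.
  by rewrite /model/= -lerBrDl ler_pdivlMr// mulrC.
rewrite iid_setX// big_mxvec_index -prodEFin [RHS]big_mkcond/=.
apply: eq_bigr => p _; rewrite AE; case: ifPn => hp; first exact: gauss_le.
exact: probability_setT.
Qed.

End pair_field.

(** For [n >= 2] the maximum runs over a nonempty family, so it is finite and [fine] is faithful;
    [fine] would send [-oo] to 0. *)
Lemma pair_max_le (R : realType) (S : Type) n (X : 'I_n -> 'I_n -> S -> R) (t : S) (y : R) :
  (2 <= n)%N ->
  (fine (pair_max X t) <= y) <-> (forall p : 'I_n * 'I_n, (p.1 < p.2)%N -> X p.1 p.2 t <=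
    y).
Proof.
move=> n2; have le (v : \bar R) : (pair_max X t <= v)%E <->
    (forall p : 'I_n * 'I_n, (p.1 < p.2)%N -> ((X p.1 p.2 t)%:E <= v)%E).
  split.
    move=> /bigmax_leP[_ h] [i j]/= ij; have /bigmax_leP[_ h2] := h i isT.
    exact: h2.
  move=> h; apply/bigmax_leP; split; first exact: leNye.
  move=> i _; apply/bigmax_leP; split; first exact: leNye.
  by move=> j ij; exact: (h (i, j)).
have fmax : pair_max X t \is a fin_num.
  pose i0 : 'I_n := Ordinal (ltnW n2); pose i1 : 'I_n := Ordinal n2.
  rewrite fin_numE; apply/andP; split.
    apply/eqP => e; have := (le -oo%E).1; rewrite e lexx => /(_ isT (i0, i1) isT).
    by [].
  apply/eqP => e; pose M := \sum_(p : 'I_n * 'I_n) `|X p.1 p.2 t|.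
  have : (pair_max X t <= M%:E)%E.
    apply/le => p _; rewrite lee_fin (le_trans (ler_norm _))// /M (bigD1 p)//=.
    by rewrite lerDl sumr_ge0.
  by rewrite e.
by rewrite -lee_fin fineK// le; split => h p hp; have := h p hp; rewrite lee_fin.
Qed.

(** * Poisson approximation *)

Section bounded_measurable.
Context d (T : measurableType d) (R : realType).
Implicit Types (f g : T -> R) (P : probability T R).

(** An algebra of functions integrable for every probability: membership replaces all integrability
    side conditions. *)
Definition bmeas f := measurable_fun setT f /\ exists M, forall t, `|f t| <= M.

Lemma bmeas_cst (c : R) : bmeas (fun=> c).
Proof. by split; [exact: measurable_cst|exists `|c|]. Qed.

Lemma bmeasD f g : bmeas f -> bmeas g -> bmeas (fun t => f t + g t).
Proof.
move=> [mf [M fM]] [mg [N gN]]; split; first exact: measurable_funD.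
by exists (M + N) => t; apply: (le_trans (ler_normD _ _)); exact: lerD.
Qed.

Lemma bmeasM f g : bmeas f -> bmeas g -> bmeas (fun t => f t * g t).
Proof.
move=> [mf [M fM]] [mg [N gN]]; split; first exact: measurable_funM.
by exists (M * N) => t; rewrite normrM ler_pM.
Qed.

Lemma bmeasB f g : bmeas f -> bmeas g -> bmeas (fun t => f t - g t).
Proof.
move=> [mf [M fM]] [mg [N gN]]; split; first exact: measurable_funB.
by exists (M + N) => t; apply: (le_trans (ler_normB _ _)); exact: lerD.
Qed.

Lemma bmeas_sqr f : bmeas f -> bmeas (fun t => f t ^+ 2).
Proof. by move=> bf; under eq_fun do rewrite expr2; exact: bmeasM. Qed.

Lemma bmeas_norm f : bmeas f -> bmeas (fun t => `|f t|).
Proof.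
move=> [mf [M fM]]; split; first exact: measurableT_comp.
by exists M => t; rewrite normr_id.
Qed.

Lemma bmeas_sum (J : Type) (s : seq J) (D : pred J) (F : J -> T -> R) :
  (forall i, bmeas (F i)) -> bmeas (fun t => \sum_(i <- s | D i) F i t).
Proof.
move=> bF; elim: s => [|i s IH].
  by under eq_fun do rewrite big_nil; exact: bmeas_cst.
under eq_fun do rewrite big_cons.
by case: (D i) => //; exact: bmeasD.
Qed.

Lemma bmeas_prod (J : Type) (s : seq J) (D : pred J) (F : J -> T -> R) :
  (forall i, bmeas (F i)) -> bmeas (fun t => \prod_(i <- s | D i) F i t).
Proof.
move=> bF; elim: s => [|i s IH].
  by under eq_fun do rewrite big_nil; exact: bmeas_cst.
under eq_fun do rewrite big_cons.
by case: (D i) => //; exact: bmeasM.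
Qed.

Lemma bmeas_indic (A : set T) : measurable A -> bmeas (\1_A : T -> R).
Proof.
move=> mA; split; first exact: measurable_indic.
by exists 1 => t; rewrite indicE; case: (_ \in _); rewrite ?normr1 ?normr0.
Qed.

Lemma bmeas_integrable P f : bmeas f -> P.-integrable setT (EFin \o f).
Proof. by move=> [mf [M fM]]; exact: bounded_integrable fM. Qed.

Lemma RintegralE P f : bmeas f -> (\int[P]_t (f t)%:E)%E = (\int[P]_t f t)%:E.
Proof.
move=> bf; rewrite /Rintegral fineK//.
by apply: (integrable_fin_num _ (bmeas_integrable P bf)).
Qed.

Lemma Rintegral1 P (c : R) : \int[P]_t c = c.
Proof.
by rewrite Rintegral_cst// [X in fine X](@probability_setT _ _ _ P) mulr1.
Qed.

Lemma bmeas_RintegralD P f g : bmeas f -> bmeas g ->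
  \int[P]_t (f t + g t) = \int[P]_t f t + \int[P]_t g t.
Proof. by move=> bf bg; rewrite RintegralD//; exact: bmeas_integrable. Qed.

Lemma bmeas_RintegralB P f g : bmeas f -> bmeas g ->
  \int[P]_t (f t - g t) = \int[P]_t f t - \int[P]_t g t.
Proof. by move=> bf bg; rewrite RintegralB//; exact: bmeas_integrable. Qed.

Lemma bmeas_RintegralZl P f c : bmeas f -> \int[P]_t (c * f t) = c * \int[P]_t f t.
Proof. by move=> bf; rewrite RintegralZl//; exact: bmeas_integrable. Qed.

Lemma bmeas_Rintegral_sum P (J : Type) (s : seq J) (D : pred J) (F : J -> T -> R) :
  (forall i, bmeas (F i)) ->
  \int[P]_t (\sum_(i <- s | D i) F i t) = \sum_(i <- s | D i) \int[P]_t F i t.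
Proof.
move=> bF; elim: s => [|i s IH].
  by under eq_Rintegral do rewrite big_nil; rewrite big_nil Rintegral1.
under eq_Rintegral do rewrite big_cons; rewrite big_cons.
case: (D i) => //; rewrite bmeas_RintegralD ?IH//; exact: bmeas_sum.
Qed.

Lemma bmeas_le_Rintegral P f g : bmeas f -> bmeas g -> (forall t, f t <= g t) ->
  \int[P]_t f t <= \int[P]_t g t.
Proof. by move=> bf bg fg; apply: le_Rintegral => //; exact: bmeas_integrable. Qed.

Lemma bmeas_Rintegral_norm_le P f : bmeas f -> `|\int[P]_t f t| <= \int[P]_t `|f t|.
Proof. by move=> bf; apply: le_normr_Rintegral => //; exact: bmeas_integrable. Qed.

End bounded_measurable.

Lemma bmeas_comp d1 d2 (T1 : measurableType d1) (T2 : measurableType d2) (R : realType)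
  (f : T2 -> R) (g : T1 -> T2) : bmeas f -> measurable_fun setT g -> bmeas (fun t => f (g
    t)).
Proof.
move=> [mf [M fM]] mg; split; first exact: measurableT_comp.
by exists M => t.
Qed.

Lemma bmeas_Rintegral2 d1 d2 (T1 : measurableType d1) (T2 : measurableType d2)
  (R : realType)
  (P : probability T2 R) (f : T1 * T2 -> R) : bmeas f -> (forall z, 0 <= f z) ->
  bmeas (fun x => \int[P]_y f (x, y)).
Proof.
move=> [mf [M fM]] f0.
have bfx x : bmeas (fun y => f (x, y)).
  by split; [exact: measurableT_comp|exists M => y].
split.
  apply/measurable_EFinP.
  rewrite (_ : _ \o _ = fun x => (\int[P]_y (EFin \o f) (x, y))%E); last first.
    by apply/funext => x /=; rewrite -RintegralE.
  apply: measurable_fun_fubini_tonelli_F; first exact/measurable_EFinP.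
  by move=> z; rewrite lee_fin.
exists M => x; apply: le_trans (bmeas_Rintegral_norm_le P (bfx x)) _.
rewrite -[leRHS](Rintegral1 P); apply: bmeas_le_Rintegral => //.
- exact: bmeas_norm.
- exact: bmeas_cst.
Qed.

(** * Integrating out coordinates of an independent sample *)

Section resample.
Context d (T : measurableType d) (R : realType) (P : probability T R).

Lemma bmeas_tnth n (f : T -> R) (i : 'I_n)
  : bmeas f -> bmeas (fun t : n.-tuple T => f (tnth t i)).
Proof. by move=> bf; exact: (bmeas_comp bf (measurable_tnth i)). Qed.

Lemma bmeas_tnth2 n (f : T * T -> R) (i j : 'I_n) : bmeas f ->
  bmeas (fun t : n.-tuple T => f (tnth t i, tnth t j)).
Proof.
move=> bf; apply: (bmeas_comp bf).
by apply: measurable_fun_pair; exact: measurable_tnth.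
Qed.

Lemma Rintegral_resample n (i : 'I_n) (f : n.-tuple T -> R)
  : bmeas f -> (forall t, 0 <= f t) ->
  \int[iid P n]_t f t = \int[iid P n]_t \int[P]_y f (tuple_set i (t, y)).
Proof.
move=> bf f0.
have bg : bmeas (fun z => f (tuple_set i z)).
  exact: (bmeas_comp bf (measurable_tuple_set i)).
apply: EFin_inj; rewrite -!RintegralE//; last first.
  by apply: (bmeas_Rintegral2 P bg) => z; exact: f0.
rewrite (ge0_integral_iid_resample _ i)//; last first.
  by apply/measurable_EFinP; case: bf.
apply: eq_integral => t _; rewrite RintegralE//.
by apply: bmeas_comp bg _; exact: measurable_fun_pair.
Qed.

Lemma Rintegral_tnth n (i : 'I_n) (f : T -> R) : bmeas f -> (forall x, 0 <= f x) ->
  \int[iid P n]_t f (tnth t i) = \int[P]_x f x.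
Proof.
move=> bf f0; rewrite (Rintegral_resample i)//; last exact: bmeas_tnth.
by under eq_Rintegral do under eq_Rintegral do rewrite tnth_tuple_set eqxx/=;
  rewrite Rintegral1.
Qed.

Section pair_kernel.
Variable q : T * T -> R.
Hypothesis bq : bmeas q.
Hypothesis q0 : forall z, 0 <= q z.

Let h x := \int[P]_y q (x, y).
Let bh : bmeas h. Proof. exact: bmeas_Rintegral2. Qed.
Let h0 x : 0 <= h x. Proof. by apply: Rintegral_ge0 => y _. Qed.

Let bqx x : bmeas (fun y => q (x, y)).
Proof. by apply: (bmeas_comp bq); exact: measurable_fun_pair. Qed.

Lemma Rintegral_pair n (i j : 'I_n) : i != j ->
  \int[iid P n]_t q (tnth t i, tnth t j) = \int[P]_x \int[P]_y q (x, y).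
Proof.
move=> ij; rewrite (Rintegral_resample j)//; last exact: bmeas_tnth2.
under eq_Rintegral do under eq_Rintegral do rewrite !tnth_tuple_set eqxx (negbTE ij)/=.
exact: (Rintegral_tnth i bh h0).
Qed.

Lemma Rintegral_pair_disjoint n (i j k l : 'I_n) : i != j -> k != l ->
  i != k -> i != l -> j != k -> j != l ->
  \int[iid P n]_t (q (tnth t i, tnth t j) * q (tnth t k, tnth t l)) =
  (\int[P]_x \int[P]_y q (x, y)) ^+ 2.
Proof.
move=> ij kl ik il jk jl.
have bf : bmeas (fun t : n.-tuple T => q (tnth t i, tnth t j) * q (tnth t k, tnth t l)).
  by apply: bmeasM; exact: bmeas_tnth2.
rewrite (Rintegral_resample j)//; last by move=> t; rewrite mulr_ge0.
transitivity (\int[iid P n]_t (h (tnth t i) * q (tnth t k, tnth t l))).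
  apply: eq_Rintegral => t _.
  under eq_Rintegral do rewrite !tnth_tuple_set eqxx (negbTE ij)
    [k == j]eq_sym [l == j]eq_sym (negbTE jk) (negbTE jl)/= mulrC.
  by rewrite bmeas_RintegralZl; [rewrite mulrC|exact: bqx].
rewrite (Rintegral_resample i)//; last 2 first.
- by apply: bmeasM; [exact: bmeas_tnth|exact: bmeas_tnth2].
- by move=> t; rewrite mulr_ge0.
transitivity (\int[iid P n]_t ((\int[P]_x h x) * q (tnth t k, tnth t l))).
  apply: eq_Rintegral => t _.
  under eq_Rintegral do rewrite !tnth_tuple_set eqxx [k == i]eq_sym [l == i]eq_sym
    (negbTE ik) (negbTE il)/= mulrC.
  by rewrite bmeas_RintegralZl; [rewrite mulrC|exact: bh].
rewrite bmeas_RintegralZl; last exact: bmeas_tnth2.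
by rewrite Rintegral_pair// expr2.
Qed.

(** Given the shared coordinate [i], the coordinates [j] and [k] are integrated out one after the
    other, each leaving a factor [h]. *)
Lemma Rintegral_pair_common n (i j k : 'I_n) : i != j -> i != k -> j != k ->
  \int[iid P n]_t (q (tnth t i, tnth t j) * q (tnth t i, tnth t k)) =
  \int[P]_x (\int[P]_y q (x, y)) ^+ 2.
Proof.
move=> ij ik jk.
have bf : bmeas (fun t : n.-tuple T => q (tnth t i, tnth t j) * q (tnth t i, tnth t k)).
  by apply: bmeasM; exact: bmeas_tnth2.
rewrite (Rintegral_resample j)//; last by move=> t; rewrite mulr_ge0.
transitivity (\int[iid P n]_t (h (tnth t i) * q (tnth t i, tnth t k))).
  apply: eq_Rintegral => t _.
  under eq_Rintegral do rewrite !tnth_tuple_set eqxx (negbTE ij)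
    [k == j]eq_sym (negbTE jk)/= mulrC.
  by rewrite bmeas_RintegralZl; [rewrite mulrC|exact: bqx].
rewrite (Rintegral_resample k)//; last 2 first.
- by apply: bmeasM; [exact: bmeas_tnth|exact: bmeas_tnth2].
- by move=> t; rewrite mulr_ge0.
transitivity (\int[iid P n]_t ((fun x => h x ^+ 2) (tnth t i))).
  apply: eq_Rintegral => t _.
  under eq_Rintegral do rewrite !tnth_tuple_set eqxx (negbTE ik)/=.
  by rewrite bmeas_RintegralZl; [rewrite expr2|exact: bqx].
by rewrite (Rintegral_tnth i (bmeas_sqr bh))// => x; exact: sqr_ge0.
Qed.

End pair_kernel.
End resample.

Lemma dist_expRN (R : realType) (a b : R) : 0 <= a -> 0 <= b ->
  `|expR (- a) - expR (- b)| <= `|a - b|.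
Proof.
have main (x y : R) : 0 <= x -> x <= y -> expR (- x) - expR (- y) <= y - x.
  move=> x0 xy; have h1 : expR (- x) <= 1 by rewrite -[leRHS]expR0 ler_expR oppr_le0.
  have h2 : 1 + (x - y) <= expR (x - y) := expR_ge1Dx _.
  have -> : expR (- y) = expR (- x) * expR (x - y) by rewrite -expRD; congr expR; ring.
  have h3 : 0 < expR (- x) := expR_gt0 _.
  have h4 : expR (x - y) <= 1 by rewrite -[leRHS]expR0 ler_expR subr_le0.
  by nra.
move=> a0 b0; have [ab|ba] := leP a b.
  rewrite ger0_norm; last by rewrite subr_ge0 ler_expR lerN2.
  by rewrite distrC ger0_norm ?subr_ge0// main.
rewrite distrC ger0_norm; last by rewrite subr_ge0 ler_expR lerN2 ltW.
have ab : 0 <= a - b by rewrite subr_ge0 ltW.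
by rewrite (ger0_norm ab); apply: main => //; exact: ltW.
Qed.

(** [expR (- x)] lies between [1 - x] and [1 / (1 + x)], which differ by [x ^+ 2 / (1 + x)]. *)
Lemma dist_onem_expRN (R : realType) (x : R) : 0 <= x <= 1 ->
  `|(1 - x) - expR (- x)| <= x ^+ 2.
Proof.
move=> /andP[x0 x1]; have h1 : 1 + - x <= expR (- x) := expR_ge1Dx _.
have h2 : 1 + x <= expR x := expR_ge1Dx _.
have h3 : expR (- x) * expR x = 1 by rewrite -expRD addNr expR0.
have h4 : 0 < expR (- x) := expR_gt0 _.
rewrite distrC ger0_norm; last by rewrite subr_ge0.
have h5 : expR (- x) * (1 + x) <= 1 by rewrite -[leRHS]h3 ler_pM2l.
by nra.
Qed.

(** Telescoping: factors are exchanged one at a time, and all the others are at most 1. *)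
Lemma dist_prod_le (R : realDomainType) (J : Type) (s : seq J) (D : pred J) (a b : J -> R) :
  (forall i, 0 <= a i <= 1) -> (forall i, 0 <= b i <= 1) ->
  `|\prod_(i <- s | D i) a i - \prod_(i <- s | D i) b i| <= \sum_(i <- s | D i)
    `|a i - b i|.
Proof.
move=> ha hb; elim: s => [|i s IH]; first by rewrite !big_nil subrr normr0.
rewrite !big_cons; case: (D i) => //.
set A := \prod_(j <- s | D j) a j in IH *; set B := \prod_(j <- s | D j) b j in IH *.
have -> : a i * A - b i * B = (a i - b i) * A + b i * (A - B) by ring.
apply: (le_trans (ler_normD _ _)); rewrite !normrM; apply: lerD.
  rewrite ler_piMr// ger0_norm; first by apply: prodr_ile1 => j _; exact: ha.
  by apply: prodr_ge0 => j _; case/andP: (ha j).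
apply: le_trans IH; rewrite ler_piMl//; case/andP: (hb i) => h1 h2.
by rewrite ger0_norm.
Qed.

(** Either [|y| <= eta], or [|y| <= y ^+ 2 / eta]. Taken in mean, this does the work of Chebyshev's
    inequality. *)
Lemma norm_le_sqr_div (R : realFieldType) (y eta : R)
  : 0 < eta -> `|y| <= eta + y ^+ 2 / eta.
Proof.
move=> e0; have [h|h] := leP `|y| eta.
  by rewrite ler_wpDr// divr_ge0 ?sqr_ge0// ltW.
apply: ler_wpDl; first exact: ltW.
by rewrite ler_pdivlMr// -[y ^+ 2]real_normK ?num_real// expr2 ler_wpM2l// ltW.
Qed.

Section poisson.
Context d (T : measurableType d) (R : realType) (P : probability T R).
Variables (q : T * T -> R) (D : set T) (delta : R).
Hypothesis bq : bmeas q.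
Hypothesis q01 : forall z, 0 <= q z <= 1.
Hypothesis qC : forall x y, q (x, y) = q (y, x).
Hypothesis mD : measurable D.
Hypothesis qD : forall x y, D x -> D y -> q (x, y) <= delta.
Local Notation pair n := ('I_n * 'I_n)%type.

Definition trunc_kernel (z : T * T) : R := q z * (\1_D z.1 * \1_D z.2).
Local Notation q' := trunc_kernel.

Lemma bmeas_trunc_kernel : bmeas q'.
Proof.
apply: bmeasM => //; apply: bmeasM.
  exact: (bmeas_comp (bmeas_indic R mD) measurable_fst).
exact: (bmeas_comp (bmeas_indic R mD) measurable_snd).
Qed.

Lemma trunc_kernel_itv z : 0 <= q' z <= 1.
Proof.
case/andP: (q01 z) => h1 h2; rewrite /q' !indicE.
by case: (_ \in _); case: (_ \in _);
  rewrite ?mulr1 ?mulr0 ?mul0r ?mulr0 ?h1 ?h2 ?lexx ?ler01.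
Qed.

Lemma trunc_kernel_ge0 z : 0 <= q' z.
Proof. by case/andP: (trunc_kernel_itv z). Qed.

Lemma trunc_kernelC x y : q' (x, y) = q' (y, x).
Proof. by rewrite /q' qC/= [\1_D x * _]mulrC. Qed.

Lemma trunc_kernel_sqr_le z : q' z ^+ 2 <= delta * q' z.
Proof.
rewrite expr2; have [->|h] := eqVneq (q' z) 0; first by rewrite !mulr0.
rewrite ler_wpM2r ?trunc_kernel_ge0//; move: h; rewrite /q' !indicE.
have [h1|h1] := boolP (z.1 \in D); last by rewrite mul0r mulr0 eqxx.
have [h2|h2] := boolP (z.2 \in D); last by rewrite mulr0 mulr0 eqxx.
by rewrite !mulr1 => _; rewrite (surjective_pairing z); apply: qD; exact/set_mem.
Qed.

Definition kernel_mean : R := \int[P]_x \int[P]_y q' (x, y).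
(** The mean of a product of two truncated kernels with exactly one common variable, computed by
    conditioning on it. *)
Definition kernel_common : R := \int[P]_x (\int[P]_y q' (x, y)) ^+ 2.
Local Notation m := kernel_mean.
Local Notation B := kernel_common.

Definition kernel_sum n (t : n.-tuple T) : R :=
  \sum_(p : pair n | (p.1 < p.2)%N) q' (tnth t p.1, tnth t p.2).
Local Notation S := kernel_sum.

Definition npairs n : R := \sum_(p : pair n | (p.1 < p.2)%N) 1.

Lemma kernel_common_ge0 : 0 <= B.
Proof. by apply: Rintegral_ge0 => x _; exact: sqr_ge0. Qed.

Lemma bmeas_kernel_sum n : bmeas (@S n).
Proof. by apply: bmeas_sum => p; exact: (bmeas_tnth2 _ _ bmeas_trunc_kernel). Qed.

Lemma kernel_sum_mean n : \int[iid P n]_t S t = npairs n * m.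
Proof.
rewrite /S bmeas_Rintegral_sum; last by move=> p;
  exact: (bmeas_tnth2 _ _ bmeas_trunc_kernel).
rewrite /npairs mulr_suml; apply: eq_bigr => p hp; rewrite mul1r.
rewrite (Rintegral_pair _ bmeas_trunc_kernel trunc_kernel_ge0)//.
by apply: contraTneq hp => ->; rewrite ltnn.
Qed.

Lemma kernel_sqr_mean n (p : pair n) : (p.1 < p.2)%N ->
  \int[iid P n]_t (q' (tnth t p.1, tnth t p.2) ^+ 2) <= delta * m.
Proof.
move=> hp; have hn : p.1 != p.2 by apply: contraTneq hp => ->; rewrite ltnn.
rewrite /m -(Rintegral_pair P bmeas_trunc_kernel trunc_kernel_ge0 hn).
have bt : bmeas (fun t : n.-tuple T => q' (tnth t p.1, tnth t p.2)).
  exact: (bmeas_tnth2 _ _ bmeas_trunc_kernel).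
rewrite -bmeas_RintegralZl//; apply: bmeas_le_Rintegral.
- exact: bmeas_sqr.
- by apply: bmeasM => //; exact: bmeas_cst.
- by move=> t; exact: trunc_kernel_sqr_le.
Qed.

(** At least 1 whenever the pairs share an index. Its sum over all pairs of pairs is immediate,
    which avoids counting the configurations with a common index. *)
Definition overlap n (p s : pair n) : R :=
  (p.1 == s.1)%:R + (p.1 == s.2)%:R + (p.2 == s.1)%:R + (p.2 == s.2)%:R.

Lemma overlap_ge0 n (p s : pair n) : 0 <= overlap p s.
Proof. by rewrite !addr_ge0. Qed.

Lemma overlap_sum n : \sum_(p : pair n) \sum_(s : pair n) overlap p s = 4 * n%:R ^+ 3.
Proof.
have e1 (i : 'I_n) : \sum_(s : pair n) ((i == s.1)%:R : R) = n%:R.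
  rewrite -(pair_bigA _ (fun k l => (i == k)%:R))/= (bigD1 i)//= [X in _ + X]big1 ?addr0.
    by rewrite sumr_const card_ord eqxx.
  by move=> k ki; rewrite sumr_const eq_sym (negbTE ki) mul0rn.
have e2 (i : 'I_n) : \sum_(s : pair n) ((i == s.2)%:R : R) = n%:R.
  rewrite -(pair_bigA _ (fun k l => (i == l)%:R))/= exchange_big/= (bigD1 i)//= [X in _ +
    X]big1 ?addr0.
    by rewrite sumr_const card_ord eqxx.
  by move=> k ki; rewrite sumr_const eq_sym (negbTE ki) mul0rn.
rewrite (eq_bigr (fun=> 4 * n%:R)).
  by rewrite sumr_const card_prod card_ord -[LHS]mulr_natr natrM; ring.
by move=> p _; rewrite !big_split/= !e1 !e2; ring.
Qed.

Lemma kernel_pair_mean n (p s : pair n) : (p.1 < p.2)%N -> (s.1 < s.2)%N ->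
  \int[iid P n]_t (q' (tnth t p.1, tnth t p.2) * q' (tnth t s.1, tnth t s.2)) <=
  m ^+ 2 + B * overlap p s + delta * m * (p == s)%:R.
Proof.
case: p s => [i j] [k l]/= hij hkl.
have dm0 : 0 <= delta * m.
  apply: le_trans (@kernel_sqr_mean n (i, j) hij); apply: Rintegral_ge0 => t _;
    exact: sqr_ge0.
have ij : i != j by apply: contraTneq hij => ->; rewrite ltnn.
have ji : j != i by rewrite eq_sym.
have kl : k != l by apply: contraTneq hkl => ->; rewrite ltnn.
have common (a b c : 'I_n) : a != b -> a != c -> b != c ->
    \int[iid P n]_t (q' (tnth t a, tnth t b) * q' (tnth t a, tnth t c)) = B.
  by move=> *; exact: (Rintegral_pair_common _ bmeas_trunc_kernel trunc_kernel_ge0).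
have B0 := kernel_common_ge0.
have [e|ne] := eqVneq (i, j) (k, l).
  case: e => <- <-; under eq_Rintegral do rewrite -expr2.
  apply: (le_trans (@kernel_sqr_mean n (i, j) hij)).
  by rewrite mulr1 ler_wpDl// addr_ge0 ?sqr_ge0// mulr_ge0// (overlap_ge0 (i, j) (i, j)).
rewrite mulr0 addr0 /overlap/=.
(* One of the four coincidences contributes 1 to [overlap]; the other three summands are booleans,
   hence nonnegative. *)
have fin x y z : B <= m ^+ 2 + B * (x%:R + y%:R + z%:R + 1) /\
    B <= m ^+ 2 + B * (x%:R + y%:R + 1 + z%:R) /\
    B <= m ^+ 2 + B * (x%:R + 1 + y%:R + z%:R) /\
    B <= m ^+ 2 + B * (1 + x%:R + y%:R + z%:R).
  have m2 : 0 <= m ^+ 2 := sqr_ge0 _.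
  have [x0 y0 z0] : [/\ (0 : R) <= x%:R, (0 : R) <= y%:R & (0 : R) <= z%:R] by split.
  by do !split; nra.
have [ik|ik] := eqVneq i k.
  subst k; have jl : j != l by apply: contra ne => /eqP ->.
  by rewrite common//; case: (fin (i == l) (j == i) false) => _ [_ [_]];
    rewrite (negbTE jl).
have [il|il] := eqVneq i l.
  subst l; under eq_Rintegral do rewrite (trunc_kernelC (tnth _ k)).
  have jk : j != k by apply: contraTneq hij => ->; rewrite -leqNgt ltnW.
  by rewrite common//; case: (fin false (j == k) (j == i)) => _ [_ []].
have [jk|jk] := eqVneq j k.
  subst k; under eq_Rintegral do rewrite (trunc_kernelC (tnth _ i)).
  by rewrite common//; case: (fin false false (j == l)) => _ [].
have [jl|jl] := eqVneq j l.
  subst l; under eq_Rintegral do rewrite (trunc_kernelC (tnth _ i))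
    (trunc_kernelC (tnth _ k)).
  by rewrite common//; case: (fin false false false).
rewrite (Rintegral_pair_disjoint P bmeas_trunc_kernel trunc_kernel_ge0)//.
by rewrite !addr0 mulr0 addr0.
Qed.

Lemma kernel_sum_sqr_mean n : \int[iid P n]_t (S t ^+ 2) <=
  npairs n ^+ 2 * m ^+ 2 + 4 * n%:R ^+ 3 * B + npairs n * (delta * m).
Proof.
have bt (p : pair n) : bmeas (fun t : n.-tuple T => q' (tnth t p.1, tnth t p.2)).
  exact: (bmeas_tnth2 _ _ bmeas_trunc_kernel).
have -> : \int[iid P n]_t (S t ^+ 2) =
  \sum_(p : pair n | (p.1 < p.2)%N) \sum_(s : pair n | (s.1 < s.2)%N)
   \int[iid P n]_t (q' (tnth t p.1, tnth t p.2) * q' (tnth t s.1, tnth t s.2)).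
  transitivity (\int[iid P n]_t (\sum_(p : pair n | (p.1 < p.2)%N)
    \sum_(s : pair n | (s.1 < s.2)%N)
   (q' (tnth t p.1, tnth t p.2) * q' (tnth t s.1, tnth t s.2)))).
    apply: eq_Rintegral => t _; rewrite expr2 /S mulr_suml; apply: eq_bigr => p _.
    by rewrite mulr_sumr.
  rewrite bmeas_Rintegral_sum; last first.
    by move=> p; apply: bmeas_sum => s; exact: bmeasM.
  apply: eq_bigr => p _; rewrite bmeas_Rintegral_sum//.
  by move=> s; exact: bmeasM.
apply: (@le_trans _ _ (\sum_(p : pair n | (p.1 < p.2)%N) \sum_(s : pair n | (s.1 < s.2)%N)
   (m ^+ 2 + B * overlap p s + delta * m * (p == s)%:R))).
  by apply: ler_sum => p hp; apply: ler_sum => s hs; exact: kernel_pair_mean.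
under eq_bigr do rewrite !big_split/=.
rewrite !big_split/=; apply: lerD; first apply: lerD.
- rewrite le_eqVlt; apply/orP; left; apply/eqP.
  rewrite [npairs n ^+ 2]expr2 -mulrA {1}/npairs mulr_suml; apply: eq_bigr => p _.
  by rewrite mul1r /npairs mulr_suml; apply: eq_bigr => s _; rewrite mul1r.
- under eq_bigr do rewrite -mulr_sumr.
  rewrite -mulr_sumr mulrC ler_wpM2r ?kernel_common_ge0// -overlap_sum.
  rewrite big_mkcond/=; apply: ler_sum => p _; case: ifP => _; last first.
    by apply: sumr_ge0 => s _; exact: overlap_ge0.
  by rewrite big_mkcond/=; apply: ler_sum => s _; case: ifP => _ //; exact: overlap_ge0.
- rewrite /npairs mulr_suml; apply: ler_sum => p hp.
  rewrite -mulr_sumr (bigD1 p)//= eqxx big1 ?addr0 ?mulr1 ?mul1r// => s /andP[_ /negbTE sp].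
  by rewrite eq_sym sp.
Qed.

(** Three sources of error: a coordinate outside [D], the replacement of [1 - q'] by [expR (- q')],
    and the deviation of the sum from [lam]. If a coordinate leaves [D], the left side is at most 1,
    which the first sum already pays for. *)
Lemma product_dist_le n (lam eta : R) (t : n.-tuple T) : 0 <= lam -> 0 < eta ->
  `|\prod_(p : pair n | (p.1 < p.2)%N) (1 - q (tnth t p.1, tnth t p.2)) - expR (- lam)| <=
  \sum_(i < n) \1_(~` D) (tnth t i) +
  \sum_(p : pair n | (p.1 < p.2)%N) q' (tnth t p.1, tnth t p.2) ^+ 2 +
  (eta + (S t - lam) ^+ 2 / eta).
Proof.
move=> lam0 eta0.
have I0 i : 0 <= \1_(~` D) (tnth t i) :> R by rewrite indicE.
have s20 : 0 <= \sum_(p : pair n | (p.1 < p.2)%N) q' (tnth t p.1, tnth t p.2) ^+ 2.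
  by apply: sumr_ge0 => p _; exact: sqr_ge0.
have eta0' := ltW eta0.
have l0 : 0 <= eta + (S t - lam) ^+ 2 / eta.
  by rewrite addr_ge0// divr_ge0// sqr_ge0.
have [tD|/existsNP[i hi]] := pselect (forall i, D (tnth t i)); last first.
  apply: (@le_trans _ _ 1).
    set F := \prod_(_ | _) _; have F01 : 0 <= F <= 1.
      rewrite prodr_ge0/=; last by move=> p _;
        case/andP: (q01 (tnth t p.1, tnth t p.2)) => _; rewrite subr_ge0.
      by apply: prodr_ile1 => p _; case/andP: (q01 (tnth t p.1, tnth t p.2)) => h1 h2;
        rewrite subr_ge0 h2 lerBlDr lerDl.
    have h1 : expR (- lam) <= 1 by rewrite -[leRHS]expR0 ler_expR oppr_le0.
    have h2 := expR_gt0 (- lam); case/andP: F01 => a b.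
    by rewrite ler_norml; apply/andP; split; lra.
  rewrite -addrA; apply: ler_wpDr; first by rewrite addr_ge0.
  by rewrite (bigD1 i)//= indicE mem_set// lerDl sumr_ge0.
have qE (p : pair n) : q (tnth t p.1, tnth t p.2) = q' (tnth t p.1, tnth t p.2).
  by rewrite /q' !indicE !mem_set//= !mulr1.
under eq_bigr do rewrite qE.
rewrite -addrA; apply: ler_wpDl; first by rewrite sumr_ge0.
have -> : (\prod_(p : pair n | (p.1 < p.2)%N) (1 - q' (tnth t p.1, tnth t p.2))
  - expR (- lam)) =
   (\prod_(p : pair n | (p.1 < p.2)%N) (1 - q' (tnth t p.1, tnth t p.2)) - expR (- S t))
   + (expR (- S t) - expR (- lam)) by ring.
apply: (le_trans (ler_normD _ _)); apply: lerD; last first.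
  apply: (le_trans (dist_expRN _ lam0)); last exact: norm_le_sqr_div.
  by apply: sumr_ge0 => p _; exact: trunc_kernel_ge0.
rewrite /S -sumrN expR_sum.
apply: (@le_trans _ _ (\sum_(p : pair n | (p.1 < p.2)%N)
  `|(1 - q' (tnth t p.1, tnth t p.2)) - expR (- q' (tnth t p.1, tnth t p.2))|)).
  apply: dist_prod_le => p.
    by case/andP: (trunc_kernel_itv (tnth t p.1, tnth t p.2)) => h1 h2;
      rewrite subr_ge0 h2 lerBlDr lerDl.
  by rewrite expR_ge0/= -[leRHS]expR0 ler_expR oppr_le0 trunc_kernel_ge0.
by apply: ler_sum => p _; apply: dist_onem_expRN; exact: trunc_kernel_itv.
Qed.

(** The mean of [product_dist_le]. The square is centred at [lam] and expanded, so only the mean and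
    the second moment of the sum enter. *)
Lemma poisson_approximation n (lam eta : R) : 0 <= lam -> 0 < eta ->
  `|\int[iid P n]_t (\prod_(p : pair n | (p.1 < p.2)%N) (1 - q (tnth t p.1, tnth t p.2)))
    - expR (- lam)| <=
  n%:R * fine (P (~` D)) + npairs n * (delta * m) + (eta +
   ((npairs n ^+ 2 * m ^+ 2 + 4 * n%:R ^+ 3 * B + npairs n * (delta * m))
     - 2 * lam * (npairs n * m) + lam ^+ 2) / eta).
Proof.
move=> lam0 eta0.
have bt (p : pair n) : bmeas (fun t : n.-tuple T => q' (tnth t p.1, tnth t p.2)).
  exact: (bmeas_tnth2 _ _ bmeas_trunc_kernel).
have bF : bmeas (fun t : n.-tuple T => \prod_(p : pair n | (p.1 < p.2)%N)
  (1 - q (tnth t p.1, tnth t p.2))).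
  apply: bmeas_prod => p; apply: bmeasB; first exact: bmeas_cst.
  exact: (bmeas_tnth2 _ _ bq).
have bI i : bmeas (fun t : n.-tuple T => \1_(~` D) (tnth t i) : R).
  by apply: (bmeas_tnth i); apply: bmeas_indic; exact: measurableC.
have b1 : bmeas (fun t : n.-tuple T => \sum_(i < n) \1_(~` D) (tnth t i) : R)
  by exact: bmeas_sum.
have b2 : bmeas (fun t : n.-tuple T => \sum_(p : pair n | (p.1 < p.2)%N)
  q' (tnth t p.1, tnth t p.2) ^+ 2).
  by apply: bmeas_sum => p; exact: bmeas_sqr.
have bS := @bmeas_kernel_sum n.
have b3 : bmeas (fun t : n.-tuple T => (S t - lam) ^+ 2).
  by apply: bmeas_sqr; apply: bmeasB => //; exact: bmeas_cst.
have b4 : bmeas (fun t : n.-tuple T => (S t - lam) ^+ 2 / eta).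
  by apply: bmeasM => //; exact: bmeas_cst.
have b5 : bmeas (fun t : n.-tuple T => eta + (S t - lam) ^+ 2 / eta).
  by apply: bmeasD => //; exact: bmeas_cst.
have bFl : bmeas (fun t : n.-tuple T => \prod_(p : pair n | (p.1 < p.2)%N)
  (1 - q (tnth t p.1, tnth t p.2)) - expR (- lam)).
  by apply: bmeasB => //; exact: bmeas_cst.
rewrite -[X in _ - X](Rintegral1 (iid P n)) -bmeas_RintegralB//; last exact: bmeas_cst.
apply: (le_trans (bmeas_Rintegral_norm_le _ bFl)).
apply: le_trans (bmeas_le_Rintegral _ _ _ (fun t => product_dist_le t lam0 eta0)) _.
- exact: bmeas_norm.
- by apply: bmeasD => //; exact: bmeasD.
rewrite !bmeas_RintegralD//; [|exact: bmeas_cst|exact: bmeasD].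
rewrite Rintegral1; apply: lerD; first apply: lerD.
- rewrite bmeas_Rintegral_sum// (eq_bigr (fun=> fine (P (~` D)))).
    by rewrite sumr_const card_ord mulr_natl.
  move=> i _; rewrite (Rintegral_tnth P i).
  + by rewrite /Rintegral integral_indic ?setIT//; exact: measurableC.
  + by apply: bmeas_indic; exact: measurableC.
  + by move=> x; rewrite indicE.
- rewrite bmeas_Rintegral_sum; last by move=> p; exact: bmeas_sqr.
  rewrite /npairs mulr_suml; apply: ler_sum => p hp; rewrite mul1r; exact: kernel_sqr_mean.
rewrite lerD2l; under eq_Rintegral do rewrite mulrC.
rewrite bmeas_RintegralZl// mulrC ler_wpM2r ?invr_ge0 ?(ltW eta0)//.
have -> : \int[iid P n]_t ((S t - lam) ^+ 2) =
   \int[iid P n]_t (S t ^+ 2) - 2 * lam * (npairs n * m) + lam ^+ 2.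
  transitivity (\int[iid P n]_t (S t ^+ 2 - (2 * lam) * S t + lam ^+ 2)).
    by apply: eq_Rintegral => t _; ring.
  have bS2 := bmeas_sqr bS.
  have bS3 : bmeas (fun t : n.-tuple T => 2 * lam * S t) by apply: bmeasM => //;
    exact: bmeas_cst.
  rewrite bmeas_RintegralD; [|exact: bmeasB|exact: bmeas_cst].
  by rewrite bmeas_RintegralB// bmeas_RintegralZl// Rintegral1 kernel_sum_mean.
by rewrite lerD2r lerD2r kernel_sum_sqr_mean.
Qed.

End poisson.

(** * The conditional exceedance probability *)

Section conditional_kernel.
Context {R : realType}.
Local Notation gam := (@gauss R 1).
Implicit Types (r u a c : R).

Lemma measurable_gauss_tail : measurable_fun setT (@gauss_tail R).
Proof.
have m0 : measurable (`]0, +oo[%classic : set (measurableTypeR R)) by exact: measurable_itv.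
have := measurableT_comp (measurable_gauss_shift 1 m0) (@oppr_measurable R setT).
move=> h; rewrite (_ : @gauss_tail R = fine \o (fun t => gam ((fun y => - t + y)
  @^-1` `]0, +oo[%classic))).
  exact: measurableT_comp h.
apply/funext => t; rewrite /gauss_tail/=; congr (fine (gam _)).
by apply/seteqP; split => y /=; rewrite !in_itv/= !andbT addrC subr_gt0.
Qed.

Lemma gauss_tail_chernoff a t : 0 <= a -> gauss_tail t <= expR (a ^+ 2 / 2 - a * t).
Proof. by move=> a0; rewrite -lee_fin -gauss_tailE; exact: gauss1_chernoff. Qed.

Definition kernel r u (z : measurableTypeR R * measurableTypeR R)
  : R := cond_tail r u z.1 z.2.

Lemma kernel_itv r u z : 0 <= kernel r u z <= 1.
Proof. exact: gauss_tail_itv. Qed.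

Lemma bmeas_kernel r u : bmeas (kernel r u).
Proof.
split; last by exists 1 => z; case/andP: (kernel_itv r u z) => h1 h2; rewrite ger0_norm.
apply: measurableT_comp; first exact: measurable_gauss_tail.
apply: measurable_funM => //; apply: measurable_funB => //; apply: measurable_funM => //.
by apply: measurable_funD.
Qed.

Lemma kernelC r u x y : kernel r u (x, y) = kernel r u (y, x).
Proof. by rewrite /kernel/= /cond_tail (addrC x). Qed.

(** The Chernoff parameter of the pair variable is [a * Num.sqrt (1 - 2 * r)], so that [a]
    multiplies the exceedance of the field itself. *)
Lemma kernel_chernoff r u a z : r < 1 / 2 -> 0 <= a ->
  kernel r u z <= expR (a ^+ 2 * (1 - 2 * r) / 2 - a * (u - Num.sqrt r * (z.1 + z.2))).
Proof.
move=> r1 a0; have e0 : 0 < 1 - 2 * r by lra.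
have := @gauss_tail_chernoff (a * Num.sqrt (1 - 2 * r)) ((u - Num.sqrt r * (z.1 + z.2))
  / Num.sqrt (1 - 2 * r)).
rewrite mulr_ge0 ?sqrtr_ge0// => /(_ isT) h; rewrite /kernel /cond_tail.
apply: (le_trans h); rewrite ler_expR exprMn sqr_sqrtr ?(ltW e0)//.
rewrite le_eqVlt; apply/orP; left; apply/eqP; congr (_ - _).
by rewrite -[LHS]mulrA [_ * (_ / _)]mulrC divfK// gt_eqF// sqrtr_gt0.
Qed.

Lemma Rintegral_expR_affine a b : \int[gam]_x expR (a * x + b) = expR (a ^+ 2 / 2 + b).
Proof. by rewrite /Rintegral gauss1_mgf. Qed.

Lemma integrable_expR_affine a b : gam.-integrable setT (EFin \o (fun x => expR (a * x +
  b))).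
Proof.
apply/integrableP; split; first by apply/measurable_EFinP; exact: measurable_expR_affine.
under eq_integral do rewrite /= ger0_norm ?expR_ge0//.
by rewrite gauss1_mgf ltry.
Qed.

Lemma bmeas_kernel1 r u x : bmeas (fun y => kernel r u (x, y)).
Proof. by apply: (bmeas_comp (bmeas_kernel r u)); exact: measurable_fun_pair. Qed.

(** Averaging [kernel_chernoff] over the second variable adds [a ^+ 2 * r / 2]: [1 - r] is the
    variance of the field given one index variable. *)
Lemma kernel_section_chernoff r u a x : 0 <= r -> r < 1 / 2 -> 0 <= a ->
  \int[gam]_y kernel r u (x, y) <= expR (a * Num.sqrt r * x + (a ^+ 2 * (1 - r)
    / 2 - a * u)).
Proof.
move=> r0 r1 a0.
have -> : expR (a * Num.sqrt r * x + (a ^+ 2 * (1 - r) / 2 - a * u)) =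
  \int[gam]_y expR ((a * Num.sqrt r) * y + (a * Num.sqrt r * x + (a ^+ 2 * (1 - 2 * r)
    / 2 - a * u))).
  rewrite Rintegral_expR_affine exprMn sqr_sqrtr//; congr expR; by field.
apply: le_Rintegral => //.
- exact: (bmeas_integrable _ (bmeas_kernel1 r u x)).
- exact: integrable_expR_affine.
- move=> y _; apply: (le_trans (@kernel_chernoff r u a (x, y) r1 a0)) => /=.
  by rewrite ler_expR le_eqVlt; apply/orP; left; apply/eqP; ring.
Qed.

Let bsec r u : bmeas (fun x => \int[gam]_y kernel r u (x, y)).
Proof.
apply: bmeas_Rintegral2; first exact: bmeas_kernel.
by move=> z; case/andP: (kernel_itv r u z).
Qed.

(** The two index variables and the pair variable add up to a standard Gaussian, since
    [r + r + (1 - 2 * r) = 1]. *)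
Lemma kernel_full_mean r u : 0 <= r -> r < 1 / 2 ->
  \int[gam]_x \int[gam]_y kernel r u (x, y) = gauss_tail u.
Proof.
move=> r0 r1; have e0 : 0 < 1 - 2 * r by lra.
have s0 : 0 < Num.sqrt (1 - 2 * r) by rewrite sqrtr_gt0.
apply: EFin_inj; rewrite -gauss_tailE -RintegralE//.
have mu0 : measurable (`]u, +oo[%classic : set (measurableTypeR R))
  by exact: measurable_itv.
have sq a (A : set R) : measurable A -> 0 <= a ->
    gam ((fun x => Num.sqrt a * x) @^-1` A) = gauss a A.
  move=> mA a0; have aE : Num.sqrt a ^+ 2 * 1 = a by rewrite mulr1 sqr_sqrtr.
  by rewrite -[in RHS]aE; exact: gauss_scale.
have mlin a : measurable_fun setT (fun x : measurableTypeR R => a * x)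
  by exact: measurable_funM.
have mY : measurable_fun setT (fun z : measurableTypeR R * measurableTypeR R =>
    Num.sqrt r * z.1 + Num.sqrt (1 - 2 * r) * z.2).
  by apply: measurable_funD; apply: measurable_funM.
have h2 (A : set R) : measurable A ->
    (gam \x gam)%E ((fun z => Num.sqrt r * z.1 + Num.sqrt (1 - 2 * r) * z.2) @^-1` A)
      = gauss (r + (1 - 2 * r)) A.
  move=> mA; apply: (@gauss_add _ _ _ _ _ gam gam (fun x => Num.sqrt r * x)
    (fun x => Num.sqrt (1 - 2 * r) * x)) => //.
  - exact: ltW.
  - by move=> B mB; exact: sq.
  - by move=> B mB; apply: sq => //; exact: ltW.
have h3 : (gam \x (gam \x gam))%E [set z | `]u, +oo[%classic
      (Num.sqrt r * z.1 + (Num.sqrt r * z.2.1 + Num.sqrt (1 - 2 * r) * z.2.2))]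
    = gam `]u, +oo[%classic.
  have e : r + (r + (1 - 2 * r)) = 1 by ring.
  rewrite -[in RHS]e.
  apply: (@gauss_add _ _ _ _ _ gam (gam \x gam)%E (fun x => Num.sqrt r * x)
    (fun z => Num.sqrt r * z.1 + Num.sqrt (1 - 2 * r) * z.2)).
  - exact: mlin.
  - exact: mY.
  - exact: r0.
  - by rewrite addr_ge0// ltW.
  - by move=> B mB; exact: sq.
  - exact: h2.
  - exact: mu0.
rewrite -h3; apply: eq_integral => x _.
rewrite -RintegralE; last exact: bmeas_kernel1.
apply: eq_integral => y _.
rewrite /kernel /cond_tail -gauss_tailE/=; congr (gam _).
have E w : (`](u - Num.sqrt r * (x + y)) / Num.sqrt (1 - 2 * r), +oo[%classic : set R) w <->
    (`]u, +oo[%classic : set R) (Num.sqrt r * x + (Num.sqrt r * y + Num.sqrt (1 - 2 * r)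
      * w)).
  by rewrite /= !in_itv/= !andbT ltr_pdivrMr// ltrBlDl mulrDr addrA [w * _]mulrC.
apply/seteqP; split => w; rewrite /xsection/= => h.
  by do 2 apply/mem_set; exact/(E w).1.
by apply/(E w).2; exact: (set_mem (set_mem h)).
Qed.

End conditional_kernel.

Section kernel_bounds.
Context {R : realType}.
Local Notation gam := (@gauss R 1).
Variables (r c l : R).
Hypothesis r0 : 0 <= r.
Hypothesis r1 : r < 1 / 2.
Hypothesis c0 : 0 < c.
Let s : R := Num.sqrt (2 * r).
Let u : R := Num.sqrt 2 * c - l / (Num.sqrt 2 * c).
(** The tilting parameter: the leading term of [u], hence nearly the best Chernoff parameter at [u],
    and one for which [a * u] is exactly [2 * c ^+ 2 - l]. *)
Let a : R := Num.sqrt 2 * c.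
Let D : set (measurableTypeR R) := `]-oo, c]%classic.

Let w0 : (0 : R) < Num.sqrt 2. Proof. by rewrite sqrtr_gt0. Qed.
Let a0 : 0 <= a. Proof. by rewrite mulr_ge0// ltW. Qed.
Let ar : a * Num.sqrt r = s * c.
Proof. by rewrite /a /s sqrtrM// mulrAC. Qed.
Let a2 : a ^+ 2 = 2 * c ^+ 2. Proof. by rewrite exprMn sqr_sqrtr. Qed.
Let au : a * u = 2 * c ^+ 2 - l.
Proof.
have an : a != 0 by rewrite mulf_neq0// gt_eqF.
by rewrite /u -/a mulrBr -expr2 a2 [a * (l / a)]mulrC divfK. Qed.
Let rs : r = s ^+ 2 / 2. Proof. by rewrite sqr_sqrtr ?mulr_ge0// mulrC mulKf. Qed.
Let s0 : 0 <= s. Proof. exact: sqrtr_ge0. Qed.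
Let s1 : s < 1. Proof. by rewrite /s -[ltRHS]sqrtr1 ltr_sqrt//; have := r1; lra. Qed.

Let mD : measurable D. Proof. exact: measurable_itv. Qed.
Let q := kernel r u.
Let bq : bmeas q. Proof. exact: bmeas_kernel. Qed.
Let q01 z : 0 <= q z <= 1. Proof. exact: kernel_itv. Qed.
Let q0 z : 0 <= q z. Proof. by case/andP: (q01 z). Qed.
Let bH : bmeas (fun x => \int[gam]_y q (x, y)). Proof. exact: bmeas_Rintegral2. Qed.

(** The Chernoff parameter 1 is crude, but the bound has only to tend to 0, and
    [u - Num.sqrt 2 * s * c] is about [Num.sqrt 2 * c * (1 - s)]. *)
Lemma kernel_delta x y : D x -> D y -> q (x, y) <= expR (1 / 2 - (u - Num.sqrt 2 * s * c)).
Proof.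
rewrite /D/= !in_itv/= => xc yc.
apply: (le_trans (kernel_chernoff u (x, y) r1 (@ler01 R))) => /=.
have sr0 : 0 <= Num.sqrt r := sqrtr_ge0 _.
have e : Num.sqrt 2 * s = 2 * Num.sqrt r by rewrite /s sqrtrM// mulrA -expr2 sqr_sqrtr.
rewrite ler_expR expr1n !mul1r e.
by have := ler_wpM2l sr0 xc; have := ler_wpM2l sr0 yc; have := r0; lra.
Qed.

Let q' := trunc_kernel q D.
Let bq' : bmeas q'. Proof. exact: bmeas_trunc_kernel. Qed.
Let q'0 z : 0 <= q' z. Proof. exact: trunc_kernel_ge0. Qed.

Let q'q z : q' z <= q z.
Proof.
rewrite /q' /trunc_kernel !indicE.
by case: (_ \in _); case: (_ \in _); rewrite ?mulr1 ?mulr0 ?mul0r ?mulr0.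
Qed.

Lemma kernel_mean_ub : kernel_mean gam q D <= gauss_tail u.
Proof.
rewrite -(kernel_full_mean u r0 r1); apply: bmeas_le_Rintegral.
- exact: bmeas_Rintegral2.
- exact: bH.
move=> x; apply: bmeas_le_Rintegral.
- by apply: (bmeas_comp bq'); exact: measurable_fun_pair.
- exact: bmeas_kernel1.
- by move=> y; exact: q'q.
Qed.

Let f (z : measurableTypeR R * measurableTypeR R) : R := \1_(~` D) z.1 * q z.

Let bf : bmeas f.
Proof.
apply: bmeasM => //; apply: (bmeas_comp _ measurable_fst).
by apply: bmeas_indic; exact: measurableC.
Qed.
Let f0 z : 0 <= f z. Proof. by rewrite /f mulr_ge0// indicE. Qed.

(* Exponential tilting by [a (G_12 - u) + th (Z_1 - c)]; minimising over [th]
   for [a = sqrt 2 c] gives [th = (1 - s) c]. *)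
Let f_mean : \int[gam]_x \int[gam]_y f (x, y) <=
  expR (- c ^+ 2 - c ^+ 2 * (1 - s) ^+ 2 / 2 + l).
Proof.
pose th := (1 - s) * c.
have th0 : 0 <= th by rewrite mulr_ge0// ?subr_ge0 ltW.
have -> : expR (- c ^+ 2 - c ^+ 2 * (1 - s) ^+ 2 / 2 + l) =
  \int[gam]_x expR ((th + a * Num.sqrt r) * x + (- th * c + (a ^+ 2 * (1 - r)
    / 2 - a * u))).
  by rewrite Rintegral_expR_affine ar a2 au rs /th; congr expR; field.
apply: le_Rintegral => //.
- by apply: bmeas_integrable; exact: bmeas_Rintegral2.
- exact: integrable_expR_affine.
move=> x _; rewrite /f/= bmeas_RintegralZl; last exact: bmeas_kernel1.
rewrite indicE; case: (boolP (x \in _)) => h; last by rewrite mul0r expR_ge0.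
move: h; rewrite mul1r inE /D/= in_itv/= => /negP; rewrite -ltNge => cx.
apply: (le_trans (kernel_section_chernoff u x r0 r1 a0)).
by rewrite ler_expR mulrDl -!addrA [leRHS]addrCA lerD2l addrA -[leLHS]add0r lerD2r; nra.
Qed.

(** Truncation loses mass only if one of the two variables exceeds [c]; the factor 2 is the union
    bound. *)
Lemma kernel_mean_lb : gauss_tail u - 2 * expR (- c ^+ 2 - c ^+ 2 * (1 - s) ^+ 2 / 2 + l) <=
  kernel_mean gam q D.
Proof.
apply: (@le_trans _ _ (gauss_tail u - 2 * \int[gam]_x \int[gam]_y f (x, y))).
  by rewrite lerB// ler_pM2l.
rewrite -(kernel_full_mean u r0 r1) -/q.
(* On a sample of size 2 the coordinates can be read in either order with the same mean, so both
   halves of the union bound are compared pointwise under one integral. *)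
pose i0 : 'I_2 := ord0; pose i1 : 'I_2 := ord_max.
have E g : bmeas g -> (forall z, 0 <= g z) ->
    \int[iid gam 2]_t g (tnth t i0, tnth t i1) = \int[gam]_x \int[gam]_y g (x, y).
  by move=> bg g0; exact: Rintegral_pair.
have E' g : bmeas g -> (forall z, 0 <= g z) ->
    \int[iid gam 2]_t g (tnth t i1, tnth t i0) = \int[gam]_x \int[gam]_y g (x, y).
  by move=> bg g0; exact: Rintegral_pair.
rewrite /kernel_mean -/q' -(E q)// -(E q')// mulrDl mul1r -{1}(E f)// -(E' f)//.
have b1 := bmeas_tnth2 i0 i1 bq; have b2 := bmeas_tnth2 i0 i1 bq'.
have b3 := bmeas_tnth2 i0 i1 bf; have b4 := bmeas_tnth2 i1 i0 bf.
rewrite -bmeas_RintegralD// -bmeas_RintegralB//; last exact: bmeasD.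
apply: bmeas_le_Rintegral => //; first by apply: bmeasB => //; exact: bmeasD.
move=> t; rewrite /f /q' /trunc_kernel /= /q (kernelC _ _ (tnth t i1)) -/q.
have := q0 (tnth t i0, tnth t i1); set qq := q _ => qq0.
by rewrite !indicE !in_setC; case: (_ \in D); case: (_ \in D) => /=; lra.
Qed.

(* Exponential tilting by [a (G_12 + G_13 - 2 u) + th (c - Z_1)]; the choice
   [a = sqrt 2 c], [th = s c] is not optimal, but it suffices for every [s < 1]. *)
Lemma kernel_common_ub : kernel_common gam q D <=
  expR (- (3 / 2 * c ^+ 2) - c ^+ 2 * (1 - s) ^+ 2 / 2 + 2 * l).
Proof.
pose th := s * c.
have th0 : 0 <= th by rewrite mulr_ge0// ltW.
have -> : expR (- (3 / 2 * c ^+ 2) - c ^+ 2 * (1 - s) ^+ 2 / 2 + 2 * l) =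
  \int[gam]_x expR ((2 * (a * Num.sqrt r) - th) * x + (th * c + 2 * (a ^+ 2 * (1 - r)
    / 2 - a * u))).
  by rewrite Rintegral_expR_affine ar a2 au rs /th; congr expR; field.
apply: le_Rintegral => //.
- by apply: bmeas_integrable; apply: bmeas_sqr; exact: bmeas_Rintegral2.
- exact: integrable_expR_affine.
(* Beyond [c] the truncated kernel vanishes; below [c] the tilt [th * (c - x)] is nonnegative. *)
move=> x _; have [cx|xc] := ltP c x.
  have Dx : \1_D x = 0 :> R.
    by rewrite indicE memNset//= /D/= in_itv/=; apply/negP; rewrite -ltNge.
  under eq_Rintegral do rewrite /trunc_kernel /= Dx mul0r mulr0.
  by rewrite Rintegral1 expr0n/= expR_ge0.
have h : \int[gam]_y q' (x, y) <= expR (a * Num.sqrt r * x + (a ^+ 2 * (1 - r)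
  / 2 - a * u)).
  apply: le_trans (kernel_section_chernoff u x r0 r1 a0); apply: bmeas_le_Rintegral.
  - by apply: (bmeas_comp bq'); exact: measurable_fun_pair.
  - exact: bmeas_kernel1.
  - by move=> y; exact: q'q.
have h0 : 0 <= \int[gam]_y q' (x, y) by apply: Rintegral_ge0 => y _.
apply: (@le_trans _ _ (expR (a * Num.sqrt r * x + (a ^+ 2 * (1 - r) / 2 - a * u)) ^+ 2)).
  by rewrite ler_sqr// nnegrE expR_ge0.
rewrite expr2 -expRD ler_expR.
have := ler_wpM2l th0 xc; rewrite ar; lra.
Qed.

End kernel_bounds.

(** * Asymptotics *)

(** The [n ^ 2] ordered pairs split into the diagonal and two halves exchanged by swapping
    coordinates. *)
Lemma npairsE (R : realType) n : npairs R n = n%:R * (n%:R - 1) / 2.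
Proof.
have e : 2 * npairs R n + n%:R = n%:R ^+ 2.
  have tot : \sum_(p : 'I_n * 'I_n) (1 : R) = n%:R ^+ 2.
    by rewrite sumr_const card_prod card_ord natrM expr2.
  have sw : \sum_(p : 'I_n * 'I_n | (p.2 < p.1)%N) (1 : R) = npairs R n.
    rewrite /npairs (reindex (fun p : 'I_n * 'I_n => (p.2, p.1)))//=.
    by exists (fun p : 'I_n * 'I_n => (p.2, p.1)) => -[].
  have dg : \sum_(p : 'I_n * 'I_n | p.1 == p.2) (1 : R) = n%:R.
    rewrite -(pair_big_dep xpredT (fun i j => i == j) (fun _ _ => 1))/=.
    rewrite (eq_bigr (fun=> 1)) ?sumr_const ?card_ord// => i _.
    by rewrite (bigD1 i)//= big1 ?addr0// => j /andP[/eqP -> ]; rewrite eqxx.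
  rewrite -tot (bigID (fun p : 'I_n * 'I_n => (p.1 < p.2)%N))/= -/(npairs R n).
  rewrite [X in _ = _ + X](bigID (fun p : 'I_n * 'I_n => p.1 == p.2))/=.
  have -> : \sum_(i : 'I_n * 'I_n | ~~ (i.1 < i.2)%N && (i.1 == i.2)) (1 : R) = n%:R.
    rewrite -dg; apply: eq_bigl => -[i j]/=; case: eqP => [->|]; rewrite ?ltnn// andbF//.
  have -> : \sum_(i : 'I_n * 'I_n | ~~ (i.1 < i.2)%N && (i.1 != i.2)) (1 : R) = npairs R n.
    by rewrite -sw; apply: eq_bigl => -[i j]/=;
      rewrite -leqNgt ltn_neqAle andbC -(inj_eq val_inj) eq_sym.
  by ring.
lra.
Qed.

Lemma ln_cvgy (R : realType) (f : nat -> R) : f @ \oo --> +oo -> (fun n => ln (f n))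
  @ \oo --> +oo.
Proof.
move=> /cvgryPge fy; apply/cvgryPge => A; near=> n.
rewrite -(expRK A) ler_ln ?posrE ?expR_gt0//; first by near: n; exact: fy.
by apply: (@lt_le_trans _ _ (expR A)); [exact: expR_gt0|near: n; exact: fy].
Unshelve. all: by end_near. Qed.

(** The square of [z / 2 <= expR (z / 2)]; it gives an explicit rate where an exponential competes
    with a power of [z]. *)
Lemma expRN_le_sqr (R : realType) (z : R) : 0 < z -> expR (- z) <= 4 * z^-1 ^+ 2.
Proof.
move=> z0; have h : 1 + z / 2 <= expR (z / 2) := expR_ge1Dx _.
have h2 : (z / 2) ^+ 2 <= expR z.
  have -> : expR z = expR (z / 2) ^+ 2 by rewrite expr2 -expRD; congr expR; field.
  by rewrite ler_sqr ?nnegrE ?expR_ge0 ?divr_ge0 ?ltW//; lra.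
rewrite expRN -[leRHS]invrK lef_pV2 ?posrE ?expR_gt0 ?invr_gt0//; last first.
  by rewrite mulr_gt0// exprn_gt0// invr_gt0.
by apply: le_trans h2; rewrite le_eqVlt; apply/orP; left; apply/eqP; field; rewrite gt_eqF.
Qed.

Section asymptotics.
Context {R : realType} (r : nat -> R) (x : R).
Hypothesis hr : forall n, (2 <= n)%N -> 0 <= r n <= 1 / 2.
Hypothesis hg : (fun n : nat => (1 - 2 * r n) * Num.sqrt (ln (n%:R : R))
  / ln (ln (n%:R : R)))
     @ \oo --> +oo.

Definition scale (n : nat) : R := Num.sqrt (2 * ln (n%:R : R)).
Definition shift n : R := ln (4 * Num.sqrt pi * scale n) - x.
Definition level n : R := Num.sqrt 2 * scale n - shift n / (Num.sqrt 2 * scale n).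
Local Notation c := scale.
Local Notation l := shift.
Local Notation u := level.
(** The natural scale: [sqrt (ln n) = expR z], [c = sqrt 2 * expR z] and [l = K + z], so every limit
    compares exponentials and powers of [z]. *)
Let z n : R := ln (ln n%:R) / 2.
Let g n : R := (1 - 2 * r n) * Num.sqrt (ln n%:R) / ln (ln n%:R).
Let s n : R := Num.sqrt (2 * r n).
Let K : R := ln (4 * Num.sqrt pi * Num.sqrt 2) - x.

Let lny : (fun n : nat => ln (n%:R : R)) @ \oo --> +oo.
Proof. exact/ln_cvgy/cvgr_idn. Qed.

Let zy : z @ \oo --> +oo.
Proof.
have /cvgryPge h := ln_cvgy lny; apply/cvgryPge => A.
by apply: filterS (h (A * 2)) => n; rewrite /z ler_pdivlMr.
Qed.

Let zV0 : (fun n => (z n)^-1) @ \oo --> 0.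
Proof.
apply/(@gtr0_cvgV0 _ _ _ _ z); last exact: zy.
by move/cvgryPgt: zy => /(_ 0).
Qed.

(** The value 2 yields a gap of at least [4 * z ^+ 2], which dominates [2 * l = 2 * K + 2 * z]. *)
Let regular n := [/\ (2 <= n)%N, 0 < ln (n%:R : R), 0 < z n & 2 <= g n].

Let good : \forall n \near \oo, regular n.
Proof.
near=> n; split; near: n.
- exact: nbhs_infty_ge.
- by move/cvgryPgt: lny => /(_ 0).
- by move/cvgryPgt: zy => /(_ 0).
- by move/cvgryPge: hg => /(_ 2).
Unshelve. all: by end_near. Qed.

Let scaleE n : 0 < ln (n%:R : R) -> c n = Num.sqrt 2 * expR (z n).
Proof.
move=> ln0; rewrite /scale sqrtrM//; congr (_ * _).
apply: (@pexpIrn _ 2%N) => //; rewrite ?nnegrE ?sqrtr_ge0 ?expR_ge0//.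
by rewrite sqr_sqrtr ?(ltW ln0)// expr2 -expRD -[LHS]lnK ?posrE//; congr expR;
  rewrite /z; field.
Qed.

Let w0 : (0 : R) < Num.sqrt 2. Proof. by rewrite sqrtr_gt0. Qed.

Lemma scale_gt0 n : 0 < ln (n%:R : R) -> 0 < c n.
Proof. by move=> h; rewrite /scale sqrtr_gt0 mulr_gt0. Qed.

Let shiftE n : 0 < ln (n%:R : R) -> l n = K + z n.
Proof.
move=> ln0; rewrite /shift scaleE// mulrA lnM ?posrE ?expR_gt0 ?mulr_gt0 ?sqrtr_gt0
  ?pi_gt0//.
by rewrite expRK /K addrAC.
Qed.

Let expz n : 0 < ln (n%:R : R) -> Num.sqrt (ln n%:R) = expR (z n).
Proof.
move=> ln0; have := scaleE ln0; rewrite /scale sqrtrM// => /mulfI; apply.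
by rewrite gt_eqF.
Qed.

(** [1 - 2 r = (1 - s) (1 + s)] is at most [2 (1 - s)]: the hypothesis on [1 - 2 r] passes to
    [1 - s]. *)
Let onem_s n : (2 <= n)%N -> 0 < ln (n%:R : R) -> 0 < z n -> g n * z n <= (1 - s n)
  * expR (z n).
Proof.
move=> n2 ln0 z0; case/andP: (hr n2) => r0 r1.
have yE : ln (ln (n%:R : R)) = 2 * z n by rewrite /z mulrC divfK.
have -> : g n * z n = (1 - 2 * r n) * expR (z n) / 2.
  by rewrite /g expz// yE; field; rewrite gt_eqF.
rewrite mulrAC ler_pM2r ?expR_gt0//.
have s2 : s n ^+ 2 = 2 * r n by rewrite sqr_sqrtr// mulr_ge0.
have s0 : 0 <= s n := sqrtr_ge0 _.
have s1 : s n <= 1 by rewrite -[leRHS]sqrtr1 ler_wsqrtr//; lra.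
by rewrite -s2; nra.
Qed.

Let gap_ge n : (2 <= n)%N -> 0 < ln (n%:R : R) -> 0 < z n -> 2 <= g n ->
  4 * z n ^+ 2 <= c n ^+ 2 * (1 - s n) ^+ 2 / 2.
Proof.
move=> n2 ln0 z0 g2; have h := onem_s n2 ln0 z0.
have h2 : 2 * z n <= (1 - s n) * expR (z n) by apply: le_trans h; rewrite ler_pM2r.
have -> : c n ^+ 2 * (1 - s n) ^+ 2 / 2 = ((1 - s n) * expR (z n)) ^+ 2.
  by rewrite scaleE// !exprMn sqr_sqrtr//; field.
rewrite (_ : 4 * z n ^+ 2 = (2 * z n) ^+ 2); last by ring.
have a0 : 0 <= 2 * z n by rewrite mulr_ge0// ltW.
by rewrite ler_sqr ?nnegrE// (le_trans a0 h2).
Qed.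

Let expRNz0 (k : R) : (fun n => expR (k - z n)) @ \oo --> 0.
Proof.
apply: (@squeeze_cvgr _ _ _ _ (fun=> 0) (fun n => expR k * (4 * (z n)^-1 ^+ 2))).
- near=> n; have [_ _ z0 _] : regular n by near: n; exact: good.
  by rewrite expR_ge0/= expRD ler_pM2l ?expR_gt0// expRN_le_sqr.
- exact: cvg_cst.
- rewrite -(mulr0 (expR k)); apply: cvgM; first exact: cvg_cst.
  rewrite -(mulr0 4); apply: cvgM; first exact: cvg_cst.
  rewrite -(mulr0 0); under eq_fun do rewrite expr2; exact: cvgM.
Unshelve. all: by end_near. Qed.

Let gap_cvg : (fun n => expR (2 * l n - c n ^+ 2 * (1 - s n) ^+ 2 / 2)) @ \oo --> 0.
Proof.
apply: (@squeeze_cvgr _ _ _ _ (fun=> 0) (fun n => expR (2 * K + 1 - z n))).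
- near=> n; have [n2 ln0 z0 g2] : regular n by near: n; exact: good.
  rewrite expR_ge0/= ler_expR shiftE//.
  (* From [(2 z - 1) ^ 2 >= 0], [2 z - 4 z ^ 2 <= 1 - 2 z], which is at most [1 - z]. *)
  by have := gap_ge n2 ln0 z0 g2; have := sqr_ge0 (2 * z n - 1); rewrite expr2; nra.
- exact: cvg_cst.
- exact: expRNz0.
Unshelve. all: by end_near. Qed.

Let gap_cvg1 : (fun n => expR (l n - c n ^+ 2 * (1 - s n) ^+ 2 / 2)) @ \oo --> 0.
Proof.
apply: (@squeeze_cvgr _ _ _ _ (fun=> 0) (fun n => expR (K + 1 - z n))).
- near=> n; have [n2 ln0 z0 g2] : regular n by near: n; exact: good.
  rewrite expR_ge0/= ler_expR shiftE//.
  by have := gap_ge n2 ln0 z0 g2; have := sqr_ge0 (2 * z n - 1); rewrite expr2; nra.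
- exact: cvg_cst.
- exact: expRNz0.
Unshelve. all: by end_near. Qed.

Let delta_cvg : (fun n => expR (1 / 2 - (u n - Num.sqrt 2 * s n * c n))) @ \oo --> 0.
Proof.
apply: (@squeeze_cvgr _ _ _ _ (fun=> 0) (fun n => expR (`|K| + 2 - z n))).
- near=> n; have [n2 ln0 z0 g2] : regular n by near: n; exact: good.
  rewrite expR_ge0/= ler_expR /level shiftE// scaleE// mulrA -expr2 sqr_sqrtr//.
  have h := onem_s n2 ln0 z0.
  have h2 : 2 * z n <= (1 - s n) * expR (z n) by apply: le_trans h; rewrite ler_pM2r.
  have e1 : 1 + z n <= expR (z n) := expR_ge1Dx _.
  have -> : Num.sqrt 2 * s n * (Num.sqrt 2 * expR (z n)) = 2 * s n * expR (z n).
    by rewrite mulrACA -expr2 sqr_sqrtr// mulrA.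
  (* The correction of the level stays bounded, because [expR z >= 1 + z]. *)
  have h3 : (K + z n) / (2 * expR (z n)) <= `|K| + 1.
    have kp : K <= `|K| := ler_norm _.
    rewrite ler_pdivrMr ?mulr_gt0 ?expR_gt0//.
    have : 0 <= `|K| * (expR (z n) - 1) by rewrite mulr_ge0// subr_ge0; lra.
    have : 0 <= `|K| := normr_ge0 _.
    nra.
  by lra.
- exact: cvg_cst.
- exact: expRNz0.
Unshelve. all: by end_near. Qed.

Let scaleV_cvg : (fun n => (c n)^-1) @ \oo --> 0.
Proof.
apply: (@squeeze_cvgr _ _ _ _ (fun=> 0) (fun n => expR (0 - z n))).
- near=> n; have [n2 ln0 z0 g2] : regular n by near: n; exact: good.
  rewrite invr_ge0 (ltW (scale_gt0 ln0))/= sub0r expRN lef_pV2 ?posrE ?expR_gt0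
    ?scale_gt0//.
  rewrite scaleE// ler_peMl ?expR_ge0// -[leLHS]sqrtr1 ler_wsqrtr//; lra.
- exact: cvg_cst.
- exact: expRNz0.
Unshelve. all: by end_near. Qed.

Let shift_cvg : (fun n => l n / c n) @ \oo --> 0.
Proof.
(* This is [(|K| + z) * (4 / z ^ 2)], with [expRN_le_sqr] applied to [expR (- z)]. *)
pose B n := 4 * `|K| * (z n)^-1 ^+ 2 + 4 * (z n)^-1.
have B0 : B @ \oo --> 0.
  rewrite -(addr0 0); apply: cvgD.
    rewrite -(mulr0 (4 * `|K|)); apply: cvgM; first exact: cvg_cst.
    by rewrite -(mulr0 0); under eq_fun do rewrite expr2; exact: cvgM.
  by rewrite -(mulr0 4); apply: cvgM; first exact: cvg_cst.
apply: (@squeeze_cvgr _ _ _ _ (fun n => - B n) B) => //; last by rewrite -oppr0;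
  exact: cvgN.
near=> n; have [n2 ln0 z0 g2] : regular n by near: n; exact: good.
rewrite -ler_norml normrM normfV (gtr0_norm (scale_gt0 ln0)).
apply: (@le_trans _ _ ((`|K| + z n) * expR (- z n))).
  apply: ler_pM; rewrite ?normr_ge0 ?invr_ge0 ?(ltW (scale_gt0 ln0))//.
    by rewrite shiftE// (le_trans (ler_normD _ _))// (gtr0_norm z0).
  rewrite expRN lef_pV2 ?posrE ?expR_gt0 ?scale_gt0//.
  rewrite scaleE// ler_peMl ?expR_ge0// -[leLHS]sqrtr1 ler_wsqrtr//; lra.
have -> : B n = (`|K| + z n) * (4 * (z n)^-1 ^+ 2).
  by rewrite /B; field; rewrite gt_eqF.
by rewrite ler_pM2l ?expRN_le_sqr// ltr_wpDl.
Unshelve. all: by end_near. Qed.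

(** The ratio of [u] to its leading term, that is [1 - l / (2 c ^ 2)], written with factors whose
    limits are known. *)
Let k n : R := 1 - l n / c n * (c n)^-1 / 2.

Let levelE n : 0 < ln (n%:R : R) -> u n = Num.sqrt 2 * c n * k n.
Proof.
move=> ln0; have c0 := scale_gt0 ln0.
have w2 : Num.sqrt 2 ^+ 2 = 2 :> R by rewrite sqr_sqrtr.
rewrite /level /k mulrBr mulr1; congr (_ - _).
have wn := w0; set w := Num.sqrt 2 in w2 wn *.
by rewrite -w2; field; rewrite !gt_eqF.
Qed.

Let k_cvg : k @ \oo --> (1 : R).
Proof.
rewrite -[X in _ --> X](subr0 1); apply: cvgB; first exact: cvg_cst.
rewrite -(mul0r 2^-1); apply: cvgM; last exact: cvg_cst.
by rewrite -(mulr0 0); apply: cvgM.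
Qed.

Let levelV_cvg : (fun n => (u n)^-1) @ \oo --> 0.
Proof.
have h : (fun n => (Num.sqrt 2)^-1 * (c n)^-1 * (k n)^-1) @ \oo --> 0.
  rewrite -(mul0r (1^-1)); apply: cvgM; last by apply: cvgV => //; exact: oner_neq0.
  by rewrite -(mulr0 (Num.sqrt 2)^-1); apply: cvgM => //; exact: cvg_cst.
apply: cvg_trans h; apply: near_eq_cvg; near=> n.
have [n2 ln0 z0 g2] : regular n by near: n; exact: good.
by rewrite levelE// !invfM.
Unshelve. all: by end_near. Qed.

Let k_gt0 : \forall n \near \oo, 0 < k n.
Proof. by have /cvgrPdist_lt := k_cvg; move=> /(_ 1 ltr01); apply: filterS => n;
  rewrite ltr_norml; lra. Qed.

(** Expanding, [u ^ 2 / 2 = c ^ 2 - l + (l / c) ^ 2 / 4]. Here [expR (- c ^ 2)] is [n ^ (-2)], and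
    [expR l] is the normalising factor. *)
Let level_sqr n : 0 < ln (n%:R : R) ->
  expR (- (u n ^+ 2 / 2)) = n%:R ^- 2 * (4 * Num.sqrt pi * c n * expR (- x))
    * expR (- ((l n / c n) ^+ 2 / 4)).
Proof.
move=> ln0; have c0 := scale_gt0 ln0.
have n0 : (0 : R) < n%:R.
  by rewrite ltNge; apply/negP => h; move: ln0; rewrite ln0// ltxx.
have -> : n%:R ^- 2 = expR (- c n ^+ 2) :> R.
  rewrite /scale sqr_sqrtr ?mulr_ge0// ?(ltW ln0)// expRN; congr (_^-1).
  by rewrite mulr_natl mulr2n expRD lnK ?posrE// expr2.
have -> : 4 * Num.sqrt pi * c n * expR (- x) = expR (l n).
  by rewrite /shift expRD lnK// posrE !mulr_gt0// sqrtr_gt0 pi_gt0.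
have w2 : Num.sqrt 2 ^+ 2 = 2 :> R by rewrite sqr_sqrtr.
rewrite -!expRD; congr expR; rewrite levelE// !exprMn w2 /k; field; rewrite gt_eqF//.
Qed.

(** The origin of [4 sqrt pi c]: the Mills denominator is about
    [sqrt (2 pi) * sqrt 2 * c = 2 sqrt pi c], and [npairs] brings another factor [1/2]. *)
Let mills_level_cvg : (fun n => npairs R n * mills (u n)) @ \oo --> expR (- x).
Proof.
pose A n : R := (1 - n%:R^-1) * expR (- x) * (k n)^-1 * expR (- ((l n / c n) ^+ 2 / 4)).
have hA : A @ \oo --> expR (- x).
  have -> : expR (- x) = (1 - 0) * expR (- x) * 1^-1 * expR (- (0 * 0 / 4)).
    by rewrite subr0 mul1r invr1 mulr1 !mul0r oppr0 expR0 mulr1.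
  apply: cvgM; last first.
    apply: (@cvg_comp _ _ _ _ expR); last exact: continuous_expR.
    apply: (@cvgN _ R^o); apply: cvgM; last exact: cvg_cst.
    by under eq_fun do rewrite expr2; exact: cvgM.
  apply: cvgM; last by apply: cvgV => //; exact: oner_neq0.
  apply: cvgM; last exact: cvg_cst.
  apply: cvgB; first exact: cvg_cst.
  apply/(@gtr0_cvgV0 _ _ _ _ (fun n : nat => n%:R : R)); last exact: cvgr_idn.
  by near=> n; rewrite ltr0n; near: n; exact: nbhs_infty_gt.
apply: cvg_trans hA; apply: near_eq_cvg; near=> n.
have [n2 ln0 z0 g2] : regular n by near: n; exact: good.
have k0 : 0 < k n by near: n; exact: k_gt0.
have c0 := scale_gt0 ln0.
have n0 : (0 : R) < n%:R by rewrite ltr0n (leq_trans _ n2).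
rewrite npairsE /mills level_sqr// levelE// sqrtrM// /A.
have w2 : Num.sqrt 2 ^+ 2 = 2 :> R by rewrite sqr_sqrtr.
have p0 : 0 < Num.sqrt pi :> R by rewrite sqrtr_gt0 pi_gt0.
set E := expR (- (_ ^+ 2 / 4)).
transitivity ((n%:R * (n%:R - 1) / 2 * (n%:R ^- 2 * (4 * Num.sqrt pi * c n * expR (- x))
  * E /
  (Num.sqrt 2 ^+ 2 * Num.sqrt pi * (c n * k n)))) : R); last first.
  by congr (_ * (_ / _)); ring.
by rewrite w2; field; rewrite !gt_eqF.
Unshelve. all: by end_near. Qed.

Lemma pairs_tail_cvg : (fun n => npairs R n * gauss_tail (u n)) @ \oo --> expR (- x).
Proof.
apply: (@squeeze_cvgr _ _ _ _ (fun n => npairs R n * mills (u n) * (1 + (u n)^-1 ^+ 2)^-1)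
  (fun n => npairs R n * mills (u n))) => //; last first.
  have e : expR (- x) = expR (- x) * (1 + 0 * 0)^-1 by rewrite mul0r addr0 invr1 mulr1.
  rewrite [X in _ --> X]e; apply: cvgM => //; apply: cvgV;
    first by rewrite mul0r addr0 oner_neq0.
  apply: cvgD; first exact: cvg_cst.
  by under eq_fun do rewrite expr2; exact: cvgM.
near=> n; have [n2 ln0 z0 g2] : regular n by near: n; exact: good.
have k0 : 0 < k n by near: n; exact: k_gt0.
have u0 : 0 < u n by rewrite levelE// !mulr_gt0 ?scale_gt0.
have N0 : 0 <= npairs R n by apply: sumr_ge0.
have d0 : 0 < 1 + u n ^- 2 by rewrite ltr_pwDl// invr_ge0 sqr_ge0.
have := gauss1_tail_lb u0; have := gauss1_tail_ub u0.
rewrite gauss_tailE -EFinM !lee_fin => h1 h2.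
rewrite exprVn -mulrA !ler_wpM2l//=.
by rewrite ler_pdivrMr// mulrC.
Unshelve. all: by end_near. Qed.

Local Notation gam := (@gauss R 1).
Let D n : set (measurableTypeR R) := `]-oo, c n]%classic.

Let exp_scale n : 0 < ln (n%:R : R) -> expR (c n ^+ 2 / 2) = n%:R.
Proof.
move=> ln0; rewrite /scale sqr_sqrtr ?mulr_ge0 ?(ltW ln0)// mulrC mulKf// lnK// posrE.
by rewrite ltNge; apply/negP => h; move: ln0; rewrite ln0// ltxx.
Qed.

(** Since [expR (- c ^ 2 / 2) = 1 / n], the Mills bound leaves only [1 / (sqrt (2 pi) c)]. *)
Let outside_cvg : (fun n => n%:R * fine (gam (~` D n))) @ \oo --> 0.
Proof.
have DE n : gam (~` D n) = gam `]c n, +oo[%classic.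
  congr (gam _); apply/seteqP; split => y /=; rewrite !in_itv/= andbT.
    by move/negP; rewrite -ltNge.
  by rewrite ltNge => /negP.
apply: (@squeeze_cvgr _ _ _ _ (fun=> 0) (fun n => (Num.sqrt (2 * pi))^-1 * (c n)^-1)).
- near=> n; have [n2 ln0 z0 g2] : regular n by near: n; exact: good.
  have c0 := scale_gt0 ln0.
  rewrite DE gauss_tailE/= mulr_ge0/=; last 2 first.
  + exact: ler0n.
  + by case/andP: (gauss_tail_itv (c n)).
  have := gauss1_tail_ub c0; rewrite gauss_tailE lee_fin => h.
  apply: (@le_trans _ _ (n%:R * mills (c n))); first by rewrite ler_wpM2l.
  rewrite /mills expRN exp_scale// invfM mulrA divff ?mul1r//.
  by rewrite pnatr_eq0 -lt0n (leq_trans _ n2).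
- exact: cvg_cst.
- by rewrite -(mulr0 (Num.sqrt (2 * pi))^-1); apply: cvgM => //; exact: cvg_cst.
Unshelve. all: by end_near. Qed.

Let q n := kernel (r n) (u n).
Let m n := kernel_mean gam (q n) (D n).
Let B n := kernel_common gam (q n) (D n).

(** At [r = 1/2] the ratio [g] would be 0. *)
Let rlt n : (2 <= n)%N -> 0 < z n -> 2 <= g n -> r n < 1 / 2.
Proof.
move=> n2 z0 g2; case/andP: (hr n2) => r0; rewrite le_eqVlt => /orP[/eqP e|//].
by move: g2; rewrite /g e (_ : 1 - 2 * (1 / 2) = 0) ?mul0r; lra.
Qed.

Let mean_cvg : (fun n => npairs R n * m n) @ \oo --> expR (- x).
Proof.
apply: (@squeeze_cvgr _ _ _ _
  (fun n => npairs R n * gauss_tail (u n) - expR (l n - c n ^+ 2 * (1 - s n) ^+ 2 / 2))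
  (fun n => npairs R n * gauss_tail (u n))); last 2 first.
- by rewrite -[X in _ --> X]subr0; apply: cvgB => //; exact: pairs_tail_cvg.
- exact: pairs_tail_cvg.
near=> n; have [n2 ln0 z0 g2] : regular n by near: n; exact: good.
have r12 := rlt n2 z0 g2; case/andP: (hr n2) => r0 _; have c0 := scale_gt0 ln0.
have N0 : 0 <= npairs R n by apply: sumr_ge0.
rewrite ler_wpM2l ?kernel_mean_ub// andbT.
apply: (@le_trans _ _ (npairs R n *
  (gauss_tail (u n) - 2 * expR (- c n ^+ 2 - c n ^+ 2 * (1 - s n) ^+ 2 / 2 + l n))));
    last first.
  by rewrite ler_wpM2l// kernel_mean_lb.
rewrite mulrBr lerB//.
(* [n ^ 2 = expR (c ^ 2)] absorbs the leading term of the truncation loss, and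
   [2 * npairs <= n ^ 2]. *)
have -> : expR (l n - c n ^+ 2 * (1 - s n) ^+ 2 / 2) =
   n%:R ^+ 2 * expR (- c n ^+ 2 - c n ^+ 2 * (1 - s n) ^+ 2 / 2 + l n).
  by rewrite -(exp_scale ln0) -expRM_natl -expRD; congr expR; field.
rewrite mulrA ler_wpM2r ?expR_ge0// npairsE.
have : (0 : R) <= n%:R by []; nra.
Unshelve. all: by end_near. Qed.

(** [n ^ 3 = expR (3 / 2 * c ^ 2)] cancels the leading term of [kernel_common_ub] exactly, which
    leaves [gap_cvg]. *)
Let common_cvg : (fun n => n%:R ^+ 3 * B n) @ \oo --> 0.
Proof.
apply: (@squeeze_cvgr _ _ _ _ (fun=> 0)
  (fun n => expR (2 * l n - c n ^+ 2 * (1 - s n) ^+ 2 / 2))); last 2 first.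
- exact: cvg_cst.
- exact: gap_cvg.
near=> n; have [n2 ln0 z0 g2] : regular n by near: n; exact: good.
have r12 := rlt n2 z0 g2; case/andP: (hr n2) => r0 _; have c0 := scale_gt0 ln0.
rewrite mulr_ge0 ?exprn_ge0 ?kernel_common_ge0//=.
apply: (@le_trans _ _ (n%:R ^+ 3 * expR (- (3 / 2 * c n ^+ 2) - c n ^+ 2 * (1 - s n)
  ^+ 2 / 2 + 2 * l n))).
  by rewrite ler_wpM2l ?exprn_ge0// kernel_common_ub.
rewrite -(exp_scale ln0) -expRM_natl -expRD ler_expR le_eqVlt; apply/orP; left;
  apply/eqP; field.
Unshelve. all: by end_near. Qed.

Lemma product_mean_cvg :
  (fun n => \int[iid gam n]_t (\prod_(p : 'I_n * 'I_n | (p.1 < p.2)%N)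
    (1 - cond_tail (r n) (u n) (tnth t p.1) (tnth t p.2)))) @ \oo --> expR (- expR (- x)).
Proof.
pose lam := expR (- x); have lam0 : 0 <= lam := expR_ge0 _.
pose dl n := expR (1 / 2 - (u n - Num.sqrt 2 * s n * c n)).
pose M n := npairs R n * m n.
apply/cvgrPdist_lt => eps eps0; pose eta := eps / 2;
  have eta0 : 0 < eta by rewrite divr_gt0.
pose err n := n%:R * fine (gam (~` D n)) + M n * dl n +
  (eta + ((M n * M n + 4 * (n%:R ^+ 3 * B n) + M n * dl n) - 2 * lam * M n + lam ^+ 2)
    / eta).
(* As [M] tends to [lam], the centred second moment tends to [lam ^ 2 - 2 lam ^ 2 + lam ^ 2 = 0];
   only the fixed [eta] survives. *)
have err_cvg : err @ \oo --> eta.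
  have -> : eta = 0 + lam * 0 + (eta + ((lam * lam + 4 * 0 + lam * 0)
    - 2 * lam * lam + lam ^+ 2) / eta).
    by field; rewrite gt_eqF.
  have hMd : (fun n => M n * dl n) @ \oo --> lam * 0 by apply: cvgM;
    [exact: mean_cvg|exact: delta_cvg].
  apply: cvgD; first by apply: cvgD => //; exact: outside_cvg.
  apply: cvgD; first exact: cvg_cst.
  apply: cvgM; last exact: cvg_cst.
  apply: cvgD; last exact: cvg_cst.
  apply: cvgB; last by apply: cvgM; [exact: cvg_cst|exact: mean_cvg].
  apply: cvgD => //; apply: cvgD; first by apply: cvgM; exact: mean_cvg.
  by apply: cvgM; [exact: cvg_cst|exact: common_cvg].
near=> n; have [n2 ln0 z0 g2] : regular n by near: n; exact: good.
have r12 := rlt n2 z0 g2; case/andP: (hr n2) => r0 _; have c0 := scale_gt0 ln0.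
rewrite distrC; apply: (@le_lt_trans _ _ (err n)); last first.
  have : `|eta - err n| < eta by near: n; move/cvgrPdist_lt: err_cvg; exact.
  by rewrite ltr_norml /eta => /andP[h _]; move: h; rewrite /eta; lra.
have := @poisson_approximation _ _ _ gam (q n) (D n) (dl n) (bmeas_kernel _ _)
  (kernel_itv _ _) (kernelC _ _) (measurable_itv _) (@kernel_delta _ _ (c n) (l n)
    r0 r12) n lam eta lam0 eta0.
move/le_trans; apply; rewrite -/(m n) -/(B n) /err le_eqVlt; apply/orP; left; apply/eqP.
by rewrite /M; congr (_ + _ + (_ + _ / _)); ring.
Unshelve. all: by end_near. Qed.

End asymptotics.

(** * The Gumbel limit *)

Unset Implicit Arguments.
Set Strict Implicit.

Theorem theorem2p1 (R : realType) (d : nat -> measure_display)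
  (T : forall n, measurableType (d n)) (P : forall n, probability (T n) R)
  (r : nat -> R) (G : forall n, 'I_n -> 'I_n -> T n -> R) :
  (forall n, (2 <= n)%N -> 0 <= r n <= 1 / 2) ->
  (forall n, (2 <= n)%N -> centered_gaussian_field (P n) (@pair_cov R n (r n)) (G n)) ->
  (fun n : nat => (1 - 2 * r n) * Num.sqrt (ln (n%:R : R)) / ln (ln (n%:R : R)))
     @ \oo --> +oo ->
  let c := fun n : nat => Num.sqrt (2 * ln (n%:R : R)) in
  forall x : R,
    (fun n : nat =>
       P n [set t | Num.sqrt 2 * c n *
                      (fine (pair_max (G n) t) - Num.sqrt 2 * c n
                       + ln (4 * Num.sqrt pi * c n) / (Num.sqrt 2 * c n)) <= x])
      @ \oo --> (expR (- expR (- x)))%:E.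
Proof.
move=> hr hG hg c x.
have lim := @product_mean_cvg R r x hr hg.
set F := (fun n => \int[_]__ _) in lim.
have limE : (fun n => (F n)%:E) @ \oo --> (expR (- expR (- x)))%:E.
  by apply: cvg_EFin; [near=> n|exact: lim].
apply: cvg_trans limE; apply: near_eq_cvg; near=> n; rewrite /F.
have n2 : (2 <= n)%N by near: n; exact: nbhs_infty_ge.
have ln0 : 0 < ln (n%:R : R).
  by near: n; move/cvgryPgt: (ln_cvgy (@cvgr_idn R)) => /(_ 0).
(* Eventual positivity of the growth ratio excludes [r = 1/2], so the pair variables have positive
   weight. *)
have r12 : r n < 1 / 2.
  have : 0 < (1 - 2 * r n) * Num.sqrt (ln (n%:R : R)) / ln (ln (n%:R : R)).
    by near: n; move/cvgryPgt: hg => /(_ 0).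
  case/andP: (hr n n2) => _; rewrite le_eqVlt => /orP[/eqP ->|//].
  by rewrite (_ : 1 - 2 * (1 / 2) = 0) ?mul0r ?ltxx//; field.
have c0 := scale_gt0 ln0; rewrite -[scale n]/(c n) in c0.
have w0 : 0 < Num.sqrt 2 * c n by rewrite mulr_gt0// sqrtr_gt0.
case/andP: (hr n n2) => r0 _; rewrite /=.
have -> : [set t | Num.sqrt 2 * c n * (fine (pair_max (G n) t) - Num.sqrt 2 * c n
     + ln (4 * Num.sqrt pi * c n) / (Num.sqrt 2 * c n)) <= x] =
   [set t | forall p : 'I_n * 'I_n, (p.1 < p.2)%N -> G n p.1 p.2 t <= level x n].
  (* [level] inverts the affine normalisation, whose slope [Num.sqrt 2 * c n] is positive. *)
  have levE (y : R) : (Num.sqrt 2 * c n * (y - Num.sqrt 2 * c n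
      + ln (4 * Num.sqrt pi * c n) / (Num.sqrt 2 * c n)) <= x) = (y <= level x n).
    rewrite -ler_pdivlMl// /level /shift -[scale n]/(c n) mulrBl (mulrC _ x).
    set a := ln _ / _; set b := x / _; set w := _ * c n.
    by apply/idP/idP; lra.
  by apply/seteqP; split => t /=; rewrite levE => /pair_max_le; exact.
rewrite (orthant_model _ r0 r12 (hG n n2)) model_orthant// RintegralE//.
apply: bmeas_prod => p; apply: bmeasB; first exact: bmeas_cst.
exact: (bmeas_tnth2 _ _ (bmeas_kernel _ _)).
Unshelve. all: by end_near. Qed.
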